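(* Consider the stochastic block model with fixed $K$ described in the context. Let $R_0=\mathrm{diag}(\sqrt{\pi_1},\dots,\sqrt{\pi_K})$, $\tilde d_0=B_0R_0^{2}\mathbf 1_K$, $\tilde{\mathcal D}_0=\mathrm{diag}(\tilde d_{01},\dots,\tilde d_{0K})$ and $\tilde{\mathcal L}_0=\tilde{\mathcal D}_0-R_0B_0R_0$. Assume that $$\mathrm{rank}(\tilde{\mathcal L}_0)=K-1,\qquad\lambda_{\max}(\tilde{\mathcal L}_0)<\lambda_{\min}(\tilde{\mathcal D}_0).$$ Fix any $q>0$. Then there exist constants $c$ and $n_0$ that depend only on $B_0$, $\pi_1,\dots,\pi_K$ and $q$ such that if $n\ge n_0$ and $$n\rho_n\ge c\log n,$$ then spectral clustering using the unnormalized Laplacian achieves exact recovery with probability at least $1-n^{-q}$.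
   Context: Stochastic block model: $K$ is fixed, each $i\in[n]=\{1,\dots,n\}$ has a label $c_i\in[K]$, $n_r=|\{i:c_i=r\}|$ with $n_r/n\to\pi_r$ for fixed $\pi_1,\dots,\pi_K>0$ summing to $1$; $B=\rho_nB_0\in[0,1]^{K\times K}$ with $B_0$ a fixed symmetric matrix and $\rho_n>0$ a rate function. The adjacency matrix $A$ is symmetric with $A_{ii}=0$ and $(A_{ij})_{i<j}$ independent with $A_{ij}\sim\mathrm{Ber}(B_{c_ic_j})$. The unnormalized Laplacian is $\mathcal L=\mathcal D-A$, where $\mathcal D$ is diagonal with $\mathcal D_{ii}=\sum_jA_{ij}$. $\lambda_{\max}(M)$ and $\lambda_{\min}(M)$ are the largest and smallest eigenvalues of $M$ in absolute value; $\mathbf 1_K$ is the all-ones vector in $\mathbb R^K$; $\tilde d_{0r}$ is the $r$-th entry of $\tilde d_0$. Spectral clustering using the unnormalized Laplacian: let $U\in\mathbb R^{n\times K}$ have as columns orthonormal eigenvectors of $\mathcal L$ corresponding to its $K$ smallest eigenvalues, with rows $U_1^{T},\dots,U_n^{T}$; apply $K$-medians, i.e. let $(\hat v_1,\dots,\hat v_K)$ minimize $\frac1n\sum_{i=1}^n\min_{r\in[K]}\|U_i-v_r\|_2$ over $(v_1,\dots,v_K)$, and output $\hat c_i=\arg\min_r\|U_i-\hat v_r\|_2$. Exact recovery is the event that there is a permutation $\pi$ of the labels $[K]$ with $\hat c_i=\pi(c_i)$ for all $i\in[n]$.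
   Formalization: The constant n_0 is allowed to depend, besides B_0, π_1,…,π_K and q, on a null sequence bounding |n_r/n − π_r| (the rate of convergence n_r/n → π_r); without this the claim fails, since at a given n all labels could coincide. The constant c depends only on B_0, π and q. *)

(* Defs.v *)
From HB Require Import structures.
From mathcomp Require Import all_boot all_order all_algebra all_fingroup.
From mathcomp Require Import all_classical all_reals all_analysis.
Set Implicit Arguments.
Unset Strict Implicit.
Unset Printing Implicit Defensive.
Import Order.TTheory GRing.Theory Num.Theory.
Import numFieldNormedType.Exports.
Local Open Scope classical_set_scope.
Local Open Scope ring_scope.

(* The norm of mathcomp-analysis on row vectors is the sup norm, hence the
   separate Euclidean norm. *)
Definition norm2 (R : realType) (m : nat) (v : 'rV[R]_m) : R :=
  Num.sqrt (\sum_(j < m) v 0 j ^+ 2).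

(* A matrix has finitely many eigenvalues, so the sup and inf below are a max
   and a min as soon as there is an eigenvalue (e.g. for a symmetric matrix of
   positive size). *)
Definition lambda_max (R : realType) (m : nat) (M : 'M[R]_m) : R :=
  sup [set x : R | exists2 a : R, eigenvalue M a & x = `|a|].

Definition lambda_min (R : realType) (m : nat) (M : 'M[R]_m) : R :=
  inf [set x : R | exists2 a : R, eigenvalue M a & x = `|a|].

Definition R0_mx (R : realType) (K : nat) (pi : 'rV[R]_K) : 'M[R]_K :=
  diag_mx (\row_(r < K) Num.sqrt (pi 0 r)).

Definition d0_vec (R : realType) (K : nat) (B0 : 'M[R]_K) (pi : 'rV[R]_K) :
    'cV[R]_K :=
  B0 *m (R0_mx pi *m R0_mx pi) *m const_mx 1.

Definition D0_mx (R : realType) (K : nat) (B0 : 'M[R]_K) (pi : 'rV[R]_K) :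
    'M[R]_K :=
  diag_mx (d0_vec B0 pi)^T.

Definition L0_mx (R : realType) (K : nat) (B0 : 'M[R]_K) (pi : 'rV[R]_K) :
    'M[R]_K :=
  D0_mx B0 pi - R0_mx pi *m B0 *m R0_mx pi.

(* Mutual independence of the family (X i), i ranging over D. *)
Definition independent_on (R : realType) (d d' : measure_display)
    (T : measurableType d) (T' : measurableType d') (P : probability T R)
    (I : finType) (D : {set I}) (X : I -> {RV P >-> T'}) : Prop :=
  forall (J : {set I}) (E : I -> set T'),
    J \subset D -> (forall i, measurable (E i)) ->
    P (\bigcap_(i in [set i | i \in J]) (X i @^-1` E i)) =
    (\prod_(i in J) P (X i @^-1` E i))%E.

(* Edges of the random graph are boolean random variables: A i j is true when
   i and j are adjacent. *)
Definition stochastic_block_model (R : realType) (d : measure_display)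
    (T : measurableType d) (P : probability T R) (n K : nat)
    (label : 'I_n -> 'I_K) (B : 'M[R]_K)
    (A : 'I_n -> 'I_n -> {RV P >-> bool}) : Prop :=
  [/\ forall i j t, A i j t = A j i t,
      forall i t, A i i t = false,
      independent_on [set e : 'I_n * 'I_n | (e.1 < e.2)%N]%SET
        (fun e => A e.1 e.2)
    & forall i j : 'I_n, (i < j)%N ->
        distribution P (A i j) = bernoulli_prob (B (label i) (label j))
          :> (set bool -> \bar R)].

Definition adjacency_mx (R : realType) (d : measure_display)
    (T : measurableType d) (P : probability T R) (n : nat)
    (A : 'I_n -> 'I_n -> {RV P >-> bool}) (t : T) : 'M[R]_n :=
  \matrix_(i, j) (A i j t : nat)%:R.

Definition laplacian (R : realType) (n : nat) (A : 'M[R]_n) : 'M[R]_n :=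
  diag_mx (\row_(i < n) \sum_(j < n) A i j) - A.

(* The columns of U are the first K vectors of some orthonormal eigenbasis W
   of M whose eigenvalues lam are listed, with multiplicity, in nondecreasing
   order.  Every such U is admitted, as ties and signs leave it undetermined. *)
Definition bottom_eigenvectors (R : realType) (n K : nat) (M : 'M[R]_n)
    (U : 'M[R]_(n, K)) : Prop :=
  (K <= n)%N /\
  exists (W : 'M[R]_n) (lam : 'rV[R]_n),
    [/\ W^T *m W = 1%:M,
        M *m W = W *m diag_mx lam,
        forall i j : 'I_n, (i <= j)%N -> lam 0 i <= lam 0 j
      & forall (k : 'I_K) (j : 'I_n), (k = j :> nat) -> col k U = col j W].

(* The inf is the minimum over the finite set of centres. *)
Definition kmedians_cost (R : realType) (n K : nat) (U : 'M[R]_(n, K))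
    (v : 'I_K -> 'rV[R]_K) : R :=
  n%:R^-1 * \sum_(i < n) inf [set norm2 (row i U - v r) | r in [set: 'I_K]].

Definition kmedians_minimizer (R : realType) (n K : nat) (U : 'M[R]_(n, K))
    (v : 'I_K -> 'rV[R]_K) : Prop :=
  forall w : 'I_K -> 'rV[R]_K, kmedians_cost U v <= kmedians_cost U w.

(* chat is a possible output of the algorithm: it comes from some admissible
   choice of eigenvectors, of K-medians centres and of nearest centres. *)
Definition spectral_clustering_output (R : realType) (n K : nat)
    (A : 'M[R]_n) (chat : 'I_n -> 'I_K) : Prop :=
  exists (U : 'M[R]_(n, K)) (v : 'I_K -> 'rV[R]_K),
    [/\ bottom_eigenvectors (laplacian A) U,
        kmedians_minimizer U v
      & forall (i : 'I_n) (r : 'I_K),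
          norm2 (row i U - v (chat i)) <= norm2 (row i U - v r)].

Definition exact_recovery (n K : nat) (label chat : 'I_n -> 'I_K) : Prop :=
  exists s : 'S_K, forall i, chat i = s (label i).

(* The guarantee does not depend on how the algorithm resolves ties. *)
Definition exact_recovery_event (R : realType) (d : measure_display)
    (T : measurableType d) (P : probability T R) (n K : nat)
    (label : 'I_n -> 'I_K) (A : 'I_n -> 'I_n -> {RV P >-> bool}) : set T :=
  [set t | forall chat : 'I_n -> 'I_K,
     spectral_clustering_output (adjacency_mx A t) chat ->
     exact_recovery label chat].

Definition label_fraction (R : realType) (n K : nat) (label : 'I_n -> 'I_K)
    (r : 'I_K) : R :=
  #|[set i | label i == r]%SET|%:R / n%:R.

(* Main.v *)
Require Import Defs.
From mathcomp Require Import all_boot all_order all_algebra all_fingroup.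
From mathcomp Require Import ring lra zify.
From mathcomp Require Import all_classical all_reals all_analysis.
Set Implicit Arguments.
Unset Strict Implicit.
Unset Printing Implicit Defensive.
Import Order.TTheory GRing.Theory Num.Theory.
Import numFieldNormedType.Exports.
Local Open Scope ring_scope.

(** Write N for n * rho, P for the matrix of the numbers rho * B0 (c_i, c_j), L
    for the Laplacian of the adjacency matrix A, and E for the Laplacian of
    A - P. A Laplacian ignores the diagonal of its matrix, so E is also the
    Laplacian of the centred adjacency matrix, and L = laplacian P + E.

    The matrix laplacian P leaves the space of block-constant vectors invariant;
    there its Rayleigh quotients are at most about N * lambda_max L0. On the
    orthogonal complement it is diagonal, with entries about N * d_r, hence at
    least about N * lambda_min D0. The assumption on L0 and D0 is therefore a
    spectral gap of order N. If the operator norm of E is at most eps * N, the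
    Courant-Fischer argument of low_eigenvalues and high_eigenvalues places
    the K smallest eigenvalues of L below the gap and the others above it.

    Exact recovery needs the eigenvectors entry by entry. If L u = lam u with lam
    below the gap, reading off the entry i gives
    (N * d_(c_i) - lam) * u_i = (P u)_i - (E u)_i. So u = ubar + T u, where ubar is
    block-constant and T is E followed by a block-constant diagonal scaling of
    order 1 / N. Iterating, u is the sum of the T ^ j ubar for j < k plus T ^ k u.
    When k is at least log n, the last term is negligible already in Euclidean
    norm. Each T ^ j ubar is, up to a block-constant scaling, a combination of the
    vectors E 1_(r1) E 1_(r2) ... E 1_(rj) 1, where 1_r projects on the block r.
    These words depend neither on u nor on lam, which removes the dependence
    between u and the rows of A: if all entries of all words of length j <= k are
    at most (eps * N) ^ j, then u is entrywise within delta / sqrt n of a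
    block-constant vector (entrywise_block_approx, eigenvector_near_block).

    Consequently the rows of U cluster around K centres. The centres are at
    distance of order 1 / sqrt n from each other (center_separation), because the
    difference of two normalised block indicators keeps a fixed share of its
    length when projected on the low eigenspace. K-medians then finds them
    (kmedians_recovery).

    It remains to see that E is small in the two senses above with probability
    at least 1 - n ^ (- q) (noise_tail). Both follow, by Markov's inequality, from
    one moment bound, walk_moment_le. The trace of E ^ (2 k) and the even powers
    of the entries of the words expand into sums over walks of products of
    centred Bernoulli variables. A product of 2 m of them has mean zero unless
    every edge in it is repeated, hence unless it has at most m distinct edges.
    Revealing the walk step by step, a step either repeats one of at most m known
    edges or takes one of n new edges, each at the price max p <= rho * beta. The
    mean is thus at most of order (N * m) ^ m, to be compared with
    (eps * N) ^ (2 m). For m of order log n and N >= c * log n the quotient is at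
    most n to an arbitrarily large negative power, once c is large. *)

(** * Products of independent centred Bernoulli variables *)

Section FiniteProduct.
Variables (R : realFieldType) (T : finType) (p : T -> R).

Definition weight (w : {ffun T -> bool}) : R := \prod_e bernoulli_pmf (p e) (w e).
Definition expect (f : {ffun T -> bool} -> R) : R := \sum_w weight w * f w.
Definition centred (w : {ffun T -> bool}) (e : T) : R := (w e)%:R - p e.
Definition monomial (h : seq T) (w : {ffun T -> bool}) : R :=
  \prod_(e <- h) centred w e.

Lemma expect_prod (F : T -> bool -> R) :
  expect (fun w => \prod_e F e (w e)) =
  \prod_e (p e * F e true + (1 - p e) * F e false).
Proof.
rewrite /expect /weight.
transitivity (\sum_(w : {ffun T -> bool}) \prod_e (bernoulli_pmf (p e) (w e) * F e (w e))).
  by apply: eq_bigr => w _; rewrite big_split.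
rewrite -(bigA_distr_bigA (fun e b => bernoulli_pmf (p e) b * F e b)) /=.
by apply: eq_bigr => e _; rewrite big_bool.
Qed.

Lemma expectD f g : expect (fun w => f w + g w) = expect f + expect g.
Proof. by rewrite /expect -big_split; apply: eq_bigr => w _; rewrite mulrDr. Qed.

Lemma expect_sum (I : Type) (s : seq I) (Q : pred I)
    (F : I -> {ffun T -> bool} -> R) :
  expect (fun w => \sum_(i <- s | Q i) F i w) =
  \sum_(i <- s | Q i) expect (F i).
Proof.
rewrite /expect exchange_big /=.
by apply: eq_bigr => w _; rewrite mulr_sumr.
Qed.

Lemma expectZ a f : expect (fun w => a * f w) = a * expect f.
Proof. by rewrite /expect mulr_sumr; apply: eq_bigr => w _; rewrite mulrCA. Qed.

Lemma eq_expect f g : f =1 g -> expect f = expect g.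
Proof. by move=> fg; apply: eq_bigr => w _; rewrite fg. Qed.

Lemma sum_weight : \sum_w weight w = 1.
Proof.
transitivity (expect (fun w => \prod_(e : T) (fun _ _ => 1) e (w e))).
  by apply: eq_bigr => w _; rewrite big1 // mulr1.
rewrite (expect_prod (fun _ _ => 1)) big1 // => e _.
by rewrite !mulr1 addrC subrK.
Qed.

Hypothesis p01 : forall e, 0 <= p e <= 1.

Lemma weight_ge0 w : 0 <= weight w.
Proof. by apply: prodr_ge0 => e _; have := bernoulli_pmf_ge0 (w e) (p01 e). Qed.

Lemma markov_weight (Q : pred {ffun T -> bool}) f :
  (forall w, 0 <= f w) -> (forall w, Q w -> 1 <= f w) ->
  \sum_(w | Q w) weight w <= expect f.
Proof.
move=> f0 f1; rewrite /expect [leRHS](bigID Q) /= -[leLHS]addr0 lerD //.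
  by apply: ler_sum => w Qw; rewrite ler_peMr ?weight_ge0 ?f1.
by apply: sumr_ge0 => w _; rewrite mulr_ge0 ?weight_ge0.
Qed.

Variable r : R.
Hypothesis p_le : forall e, p e <= r.

Lemma centred_moment e m :
  `|p e * (1 - p e) ^+ m.+2 + (1 - p e) * (0 - p e) ^+ m.+2| <= r.
Proof.
have /andP[p0 p1] := p01 e.
apply: le_trans (p_le e); apply: le_trans (ler_normD _ _) _.
have nM (a b : R) : `|a * b ^+ m.+2| = `|a| * (`|b| * `|b| ^+ m.+1).
  by rewrite normrM normrX exprS.
rewrite !nM sub0r normrN (ger0_norm p0) [`|1 - p e|]ger0_norm; last by lra.
have q1 : (1 - p e) ^+ m.+1 <= 1 - p e by rewrite ler_iXnr //; lra.
have q0 : p e ^+ m.+1 <= p e by rewrite ler_iXnr.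
move: q1 q0; set a := _ ^+ _; set b := _ ^+ _ => q1 q0.
have q2 : 0 <= 1 - p e by lra.
have q3 : 0 <= 1 - a - b by lra.
have := mulr_ge0 (mulr_ge0 p0 q2) q3; have := mulr_ge0 p0 p0; lra.
Qed.

Lemma monomialE h w :
  monomial h w = \prod_e centred w e ^+ count_mem e h.
Proof.
rewrite /monomial; elim: h => [|e h IH].
  by rewrite big_nil big1 // => e _; rewrite expr0.
rewrite big_cons IH (bigD1 e) //= [RHS](bigD1 e) //= eqxx exprS mulrA.
by congr (_ * _); apply: eq_bigr => f /negPf; rewrite eq_sym => ->.
Qed.

(** An edge that occurs exactly once makes the mean vanish by independence. If
    every edge occurs at least twice, there are at most (size h) / 2 distinct
    edges, and each contributes a moment of order at least two. *)
Lemma expect_monomial h :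
  `|expect (monomial h)| <=
  if (2 * size (undup h) <= size h)%N then r ^+ size (undup h) else 0.
Proof.
rewrite (eq_expect (monomialE h)).
rewrite (expect_prod (fun e b => (b%:R - p e) ^+ count_mem e h)).
rewrite normr_prod.
have [/existsP[e /eqP he]|/existsPn h1] := boolP [exists e, count_mem e h == 1%N].
  rewrite (bigD1 e) //= he !expr1 mulr0n mulr1n.
  rewrite (_ : p e * _ + _ = 0); last by ring.
  rewrite normr0 mul0r; case: ifP => // _; apply: exprn_ge0.
  by have /andP[p0 _] := p01 e; exact: le_trans (p_le e).
have hn : (2 * size (undup h) <= size h)%N.
  rewrite -(sum1_size h) -big_undup_iterop_count /= -sum1_size big_distrr /=.
  rewrite big_seq [leqRHS]big_seq; apply: leq_sum => e.
  rewrite mem_undup -has_pred1 has_count Monoid.iteropE iter_addn_0 mul1n.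
  by have := h1 e; case: (count_mem e h) => [|[|m]].
rewrite hn (bigID (fun e => e \in undup h)) /= [X in _ * X]big1 ?mulr1; last first.
  move=> e; rewrite mem_undup => /count_memPn ->.
  by rewrite !expr0 !mulr1 addrC subrK normr1.
rewrite -big_uniq ?undup_uniq //=.
have -> : r ^+ size (undup h) = \prod_(e <- undup h) r.
  by rewrite big_const_seq count_predT iter_mulr_1.
rewrite !(big_seq _ _ (undup h)); apply: ler_prod => e; rewrite mem_undup normr_ge0 /=.
rewrite -has_pred1 has_count; have := h1 e.
by case: (count_mem e h) => [|[|m]] // _ _; apply: centred_moment.
Qed.

Section WalkPolynomials.
Variables (n : nat) (edge : 'I_n -> 'I_n -> T).
Hypothesis edge_inj : forall v, injective (edge v).

(** Functions that expand into a sum of products of m centred variables, chosen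
    adaptively: the vertex v from which a step starts may depend on the endpoints
    c of all earlier steps, so that a product of walks, each restarting from its
    own origin, is again of this form (walk_polyM). C bounds the total weight of
    the leaves. *)
Inductive walk_poly : nat -> R -> ({ffun T -> bool} -> R) -> Prop :=
| Walk_stop C a : `|a| <= C -> walk_poly 0 C (fun=> a)
| Walk_step m C v Y : (forall c, walk_poly m C (Y c)) ->
    walk_poly m.+1 C (fun w => \sum_c centred w (edge v c) * Y c w)
| Walk_add m C C' Y Y' : walk_poly m C Y -> walk_poly m C' Y' ->
    walk_poly m (C + C') (fun w => Y w + Y' w)
| Walk_eq m C Y Y' : Y =1 Y' -> walk_poly m C Y -> walk_poly m C Y'.

Lemma walk_poly_ge0 m C Y : walk_poly m C Y -> (0 < n)%N -> 0 <= C.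
Proof.
move=> H n0; elim: H => // [D a aD|*|*]; first exact: le_trans aD.
  by auto using (Ordinal n0).
exact: addr_ge0.
Qed.

Lemma walk_poly_scale a D m C Y : `|a| <= D -> walk_poly m C Y ->
  walk_poly m (D * C) (fun w => a * Y w).
Proof.
move=> aD; elim=> {m C Y} [C b bC|m C v Y _ IH|m C C' Y Y' _ IH _ IH'|m C Y Y' e _ IH].
- by apply: Walk_stop; rewrite normrM ler_pM.
- apply: Walk_eq (Walk_step v IH) => w.
  by rewrite mulr_sumr; apply: eq_bigr => c _; rewrite mulrCA.
- by rewrite mulrDr; apply: Walk_eq (Walk_add IH IH') => w; rewrite mulrDr.
- by apply: Walk_eq IH => w; rewrite e.
Qed.

Lemma walk_polyM m C Y m' C' Y' : walk_poly m C Y -> walk_poly m' C' Y' ->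
  walk_poly (m + m') (C * C') (fun w => Y w * Y' w).
Proof.
move=> H H'; elim: H => {m C Y} [C b bC|m C v Y _ IH|m C D Y Z _ IH _ IH'|m C Y Z e _ IH].
- exact: walk_poly_scale.
- apply: Walk_eq (Walk_step v IH) => w.
  by rewrite mulr_suml; apply: eq_bigr => c _; rewrite mulrA.
- by rewrite mulrDl; apply: Walk_eq (Walk_add IH IH') => w; rewrite mulrDl.
- by apply: Walk_eq IH => w; rewrite e.
Qed.

Lemma walk_polyX j m C Y : walk_poly m C Y ->
  walk_poly (j * m) (C ^+ j) (fun w => Y w ^+ j).
Proof.
move=> H; elim: j => [|j IH].
  by apply: Walk_stop; rewrite normr1.
rewrite mulSn exprS.
by apply: Walk_eq (walk_polyM H IH) => w; rewrite exprS.
Qed.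

Lemma monomial_cons e h w : monomial (e :: h) w = centred w e * monomial h w.
Proof. by rewrite /monomial big_cons. Qed.

Lemma expect_walk_step h v (Y : 'I_n -> {ffun T -> bool} -> R) :
  expect (fun w => monomial h w * \sum_c centred w (edge v c) * Y c w) =
  \sum_c expect (fun w => monomial (edge v c :: h) w * Y c w).
Proof.
rewrite -expect_sum; apply: eq_expect => w; rewrite mulr_sumr.
by apply: eq_bigr => c _; rewrite monomial_cons mulrCA mulrA.
Qed.

(** With more than k distinct edges already in h, no completion to total length
    2 * k can repeat them all. *)
Lemma walk_expect_eq0 m C Y h k : walk_poly m C Y ->
  (size h + m <= 2 * k)%N -> (k < size (undup h))%N ->
  expect (fun w => monomial h w * Y w) = 0.
Proof.
move=> H; elim: H h => {m C Y} [C b _|m C v Y _ IH|m C D Y Z _ IH _ IH'|m C Y Z e _ IH] h hk kh.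
- apply/eqP; rewrite -normr_le0.
  under eq_expect do rewrite mulrC.
  rewrite expectZ normrM; have := expect_monomial h.
  rewrite ifF; last first.
    by apply/negbTE; rewrite -ltnNge -[size h]addn0 (leq_ltn_trans hk) // ltn_mul2l.
  by move=> e0; rewrite mulr_ge0_le0.
- rewrite expect_walk_step big1 // => c _; apply: IH => /=; first by rewrite addSnnS.
  by case: ifP => //= _; apply: ltnW.
- under eq_expect do rewrite mulrDr.
  by rewrite expectD IH ?IH' ?addr0.
- by rewrite -(IH h) //; apply: eq_expect => w; rewrite e.
Qed.

(** Bounds the weighted number of continuations by m steps of which at most b use
    new edges: kk is the weight of a repeating step, x the weight of a new one, and
    2 ^ m counts the possible patterns. *)
Definition walk_bound (x kk : R) (m b : nat) : R :=
  2 ^+ m * x ^+ minn m b * kk ^+ (m - minn m b).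

Lemma walk_bound_rec x kk m b : 0 <= kk -> kk <= x ->
  kk * walk_bound x kk m b + (if b is b'.+1 then x * walk_bound x kk m b' else 0)
  <= walk_bound x kk m.+1 b.
Proof.
move=> k0 kx; have x0 := le_trans k0 kx; rewrite /walk_bound.
have e2 : 0 <= 2 ^+ m :> R by apply: exprn_ge0.
case: (boolP (b <= m)%N) => [bm|]; last rewrite -ltnNge => mb.
  rewrite (minn_idPr bm) (minn_idPr (leqW bm)) (subSn bm).
  case: b bm => [|b] bm.
    rewrite !expr0 subn0 !exprS.
    by have := mulr_ge0 e2 (mulr_ge0 k0 (exprn_ge0 m k0)); move: (2 ^+ m) (kk ^+ m) => t y; lra.
  rewrite (minn_idPr (ltnW bm)) -(subSn bm) subSS !exprS.
  have -> : kk ^+ (m - b) = kk * kk ^+ (m - b.+1) by rewrite -exprS -subSn.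
  by rewrite le_eqVlt; apply/orP; left; apply/eqP; ring.
have mb' : (m <= b)%N by lia.
rewrite (minn_idPl mb) (minn_idPl mb') !subnn !expr0 !mulr1 !exprS.
have P : 0 <= 2 ^+ m * x ^+ m by rewrite mulr_ge0 ?exprn_ge0.
case: b mb mb' => [|b] mb _; first by lia.
rewrite (minn_idPl (_ : m <= b)%N) ?subnn ?expr0 ?mulr1 //.
by have := ler_wpM2r P kx; move: (2 ^+ m) (x ^+ m) => t y; lra.
Qed.

Lemma card_edge_le v h : (#|[pred c | edge v c \in h]| <= size (undup h))%N.
Proof.
rewrite -(fintype.card_image (@edge_inj v)) -(card_uniqP (undup_uniq h)) subset_leq_card //.
by apply/fintype.subsetP => e /mapP[c]; rewrite mem_enum mem_undup => + ->.
Qed.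

(** Induction on the exploration, with the history h of the edges used so far: a
    step either repeats one of the at most k edges of h, which leaves the number
    of distinct edges unchanged, or uses a new edge; there are n of the latter,
    each contributing a factor r to the final moment. The two cases are the two
    terms of walk_bound_rec. *)
Lemma walk_expect_le (x : R) k m C Y h : walk_poly m C Y ->
  k%:R <= x -> n%:R * r <= x -> (0 < n)%N ->
  (size h + m = 2 * k)%N -> (size (undup h) <= k)%N ->
  `|expect (fun w => monomial h w * Y w)| <=
  C * r ^+ size (undup h) * walk_bound x k%:R m (k - size (undup h)).
Proof.
move=> H kx nx n0; have C0 := walk_poly_ge0 H n0; move: C0.
elim: H h => {m C Y} [C b bC|m C v Y HY IH|m C D Y Z HY IH HZ IH'|m C Y Z e _ IH] h C0 hk kh.
- under eq_expect do rewrite mulrC.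
  rewrite expectZ normrM -mulrA ler_pM //.
  rewrite /walk_bound min0n !expr0 !mulr1.
  apply: le_trans (expect_monomial h) _; rewrite ifT //.
  by rewrite -[size h]addn0 hk leq_mul2l kh.
- rewrite expect_walk_step.
  apply: le_trans (ler_norm_sum _ _ _) _.
  rewrite (bigID [pred c | edge v c \in h]) /=.
  set d := size (undup h).
  have r0 : 0 <= r.
    by have /andP[+ _] := p01 (edge v (Ordinal n0)); move/le_trans; apply.
  have x0 : 0 <= x by apply: le_trans kx.
  have wb m' b : 0 <= walk_bound x k%:R m' b.
    by rewrite /walk_bound !mulr_ge0 ?exprn_ge0.
  have h1 : \sum_(c | edge v c \in h)
      `|expect (fun w => monomial (edge v c :: h) w * Y c w)| <=
      C * r ^+ d * (k%:R * walk_bound x k%:R m (k - d)).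
    apply: (@le_trans _ _ (\sum_(c | edge v c \in h) C * r ^+ d * walk_bound x k%:R m (k - d))).
      apply: ler_sum => c ch.
      have -> : d = size (undup (edge v c :: h)) by rewrite /= ch.
      apply: IH => //=; first by rewrite addSnnS.
      by rewrite ch.
    rewrite sumr_const -[leLHS]mulr_natr -[leLHS]mulrA [_ * _%:R]mulrC.
    apply: ler_wpM2l; first by rewrite !mulr_ge0 ?exprn_ge0.
    apply: ler_wpM2r => //.
    by rewrite ler_nat; apply: leq_trans kh; apply: card_edge_le.
  have h2 : \sum_(c | edge v c \notin h)
      `|expect (fun w => monomial (edge v c :: h) w * Y c w)| <=
      C * r ^+ d * (if (k - d)%N is b'.+1 then x * walk_bound x k%:R m b' else 0).
    case kd : (k - d)%N => [|b].
      rewrite mulr0 big1 // => c ch; rewrite (@walk_expect_eq0 m C _ _ k) ?normr0 //=.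
        by rewrite addSnnS hk.
      by rewrite (negbTE ch) /= ltnS -/d -subn_eq0 kd.
    apply: (@le_trans _ _ (\sum_(c : 'I_n) C * r ^+ d.+1 * walk_bound x k%:R m b)).
      rewrite [leLHS]big_mkcond; apply: ler_sum => c _; case: ifP => ch; last first.
        by rewrite !mulr_ge0 ?exprn_ge0.
      have dE : d.+1 = size (undup (edge v c :: h)) by rewrite /= (negbTE ch).
      have -> : b = (k - d.+1)%N by rewrite subnS kd.
      rewrite dE; apply: IH => //; last by rewrite -dE -subn_gt0 kd.
      by rewrite /= addSnnS.
    rewrite sumr_const card_ord -[leLHS]mulr_natr exprS.
    have : 0 <= C * r ^+ d * walk_bound x k%:R m b by rewrite !mulr_ge0 ?exprn_ge0.
    by move/ler_wpM2l/(_ _ _ nx); move: (r ^+ d) (walk_bound _ _ _ _) => t y; lra.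
  apply: le_trans (lerD h1 h2) _; rewrite -mulrDr.
  by apply: ler_wpM2l; [rewrite !mulr_ge0 ?exprn_ge0|apply: walk_bound_rec].
- under eq_expect do rewrite mulrDr.
  rewrite expectD; apply: le_trans (ler_normD _ _) _.
  have C1 := walk_poly_ge0 HY n0; have D1 := walk_poly_ge0 HZ n0.
  by rewrite !mulrDl lerD ?IH ?IH'.
- rewrite (eq_expect (g := fun w => monomial h w * Y w)); first exact: IH.
  by move=> w; rewrite e.
Qed.

Lemma walk_moment_le (x : R) k C Y : walk_poly (2 * k) C Y ->
  k%:R <= x -> n%:R * r <= x -> (0 < n)%N ->
  `|expect Y| <= C * (4 * x * k%:R) ^+ k.
Proof.
move=> H kx nx n0.
have := walk_expect_le (h := [::]) H kx nx n0 erefl isT.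
rewrite /= expr0 mulr1 subn0 /walk_bound (minn_idPr _) ?leq_pmull //.
rewrite mul2n -addnn addnK addnn -mul2n exprM !exprMn.
rewrite (eq_expect (g := Y)) //; last by move=> w; rewrite /monomial big_nil mul1r.
by rewrite -exprMn -natrM mulrA.
Qed.

End WalkPolynomials.
End FiniteProduct.

(** * Euclidean geometry *)

Section InnerProduct.
Variable R : realType.

Definition dot n (u v : 'cV[R]_n) : R := (u^T *m v) 0 0.

Lemma dotE n (u v : 'cV[R]_n) : dot u v = \sum_i u i 0 * v i 0.
Proof. by rewrite /dot mxE; apply: eq_bigr => i _; rewrite mxE. Qed.

Lemma dotC n (u v : 'cV[R]_n) : dot u v = dot v u.
Proof. by rewrite !dotE; apply: eq_bigr => i _; rewrite mulrC. Qed.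

Lemma dotDr n (u v w : 'cV[R]_n) : dot u (v + w) = dot u v + dot u w.
Proof. by rewrite /dot mulmxDr mxE. Qed.

Lemma dotZr n a (u v : 'cV[R]_n) : dot u (a *: v) = a * dot u v.
Proof. by rewrite /dot -scalemxAr mxE. Qed.

Lemma dotDl n (u v w : 'cV[R]_n) : dot (u + v) w = dot u w + dot v w.
Proof. by rewrite dotC dotDr !(dotC w). Qed.

Lemma dotZl n a (u v : 'cV[R]_n) : dot (a *: u) v = a * dot u v.
Proof. by rewrite dotC dotZr dotC. Qed.

Lemma dotNr n (u v : 'cV[R]_n) : dot u (- v) = - dot u v.
Proof. by rewrite -scaleN1r dotZr mulN1r. Qed.

Lemma dotBr n (u v w : 'cV[R]_n) : dot u (v - w) = dot u v - dot u w.
Proof. by rewrite dotDr dotNr. Qed.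

Lemma dotBl n (u v w : 'cV[R]_n) : dot (u - v) w = dot u w - dot v w.
Proof. by rewrite dotC dotBr !(dotC w). Qed.

Lemma dot_sumr n (I : Type) (s : seq I) (P : pred I) (u : 'cV[R]_n) F :
  dot u (\sum_(i <- s | P i) F i) = \sum_(i <- s | P i) dot u (F i).
Proof. by rewrite /dot mulmx_sumr summxE. Qed.

Lemma dot_mulmxl m n (A : 'M[R]_(m, n)) u v : dot (A *m u) v = dot u (A^T *m v).
Proof. by rewrite /dot trmx_mul mulmxA. Qed.

Lemma dot_ge0 n (u : 'cV[R]_n) : 0 <= dot u u.
Proof. by rewrite dotE sumr_ge0 // => i _; rewrite -expr2 sqr_ge0. Qed.

Lemma dot_eq0 n (u : 'cV[R]_n) : dot u u = 0 -> u = 0.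
Proof.
rewrite dotE => /eqP; rewrite psumr_eq0; last by move=> i _; rewrite -expr2 sqr_ge0.
move=> /allP u0; apply/matrixP => i j; rewrite ord1 mxE.
by have := u0 i; rewrite mem_index_enum => /(_ isT) /=; rewrite -expr2 sqrf_eq0 => /eqP.
Qed.

Lemma dot_delta n (u : 'cV[R]_n) i : dot u (delta_mx i 0) = u i 0.
Proof.
rewrite dotE (bigD1 i) //= mxE !eqxx mulr1 big1 ?addr0 // => j /negPf ji.
by rewrite mxE ji mulr0.
Qed.

Lemma sqr_entry_le_dot n (u : 'cV[R]_n) i : u i 0 ^+ 2 <= dot u u.
Proof.
rewrite dotE (bigD1 i) //= -expr2 lerDl sumr_ge0 // => j _.
by rewrite -expr2 sqr_ge0.
Qed.

Lemma cauchy_schwarz n (u v : 'cV[R]_n) : dot u v ^+ 2 <= dot u u * dot v v.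
Proof.
have [v0|v0] := eqVneq (dot v v) 0.
  by rewrite v0 mulr0 (dot_eq0 v0) /dot mulmx0 mxE expr0n.
have vp : 0 < dot v v by rewrite lt_def v0 dot_ge0.
have := dot_ge0 (dot v v *: u - dot u v *: v).
rewrite !(dotBr, dotBl, dotZr, dotZl) (dotC v u) => H.
rewrite -subr_ge0 -(pmulr_rge0 _ vp).
by apply: le_trans H _; rewrite le_eqVlt; apply/orP; left; apply/eqP; ring.
Qed.

Lemma dot_iter_mulmx n (E : 'M[R]_n) k (u v : 'cV[R]_n) : E^T = E ->
  dot (iter k (mulmx E) u) v = dot u (iter k (mulmx E) v).
Proof.
move=> symE; elim: k u v => // k IH u v.
by rewrite iterS dot_mulmxl symE IH -iterSr.
Qed.

(** The left-hand side of the trace bound is the trace of the power 2 ^ p.+1 of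
    E. Cauchy-Schwarz makes the squared lengths of the iterates E ^ j f
    log-convex along j = 1, 2, 4, 8 and so on; hence the first one is controlled
    by the one of index 2 ^ p, which the trace bounds. This replaces a
    diagonalisation of E. *)
Lemma opnorm_le_of_trace_power n (E : 'M[R]_n) (p : nat) (B : R) :
  E^T = E -> 0 <= B ->
  \sum_i dot (iter (2 ^ p) (mulmx E) (delta_mx i 0))
             (iter (2 ^ p) (mulmx E) (delta_mx i 0)) <= B ^+ (2 ^ p) ->
  forall f : 'cV[R]_n, dot (E *m f) (E *m f) <= B * dot f f.
Proof.
move=> symE B0 trB f.
have adj k (u v : 'cV[R]_n) := dot_iter_mulmx k u v symE.
have q2 k : dot (iter k (mulmx E) f) (iter k (mulmx E) f) ^+ 2 <=
    dot f f * dot (iter (2 * k) (mulmx E) f) (iter (2 * k) (mulmx E) f).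
  by rewrite adj -iterD addnn -mul2n cauchy_schwarz.
have qp m : dot (E *m f) (E *m f) ^+ (2 ^ m) <=
    dot f f ^+ (2 ^ m).-1 * dot (iter (2 ^ m) (mulmx E) f) (iter (2 ^ m) (mulmx E) f).
  elim: m => [|m IH]; first by rewrite expr0 mul1r.
  have ->: (2 ^ m.+1).-1 = (2 * (2 ^ m).-1).+1.
    by rewrite expnS; have := expn_gt0 2 m; case: (2 ^ m)%N => //= k _; lia.
  have ->: dot (E *m f) (E *m f) ^+ (2 ^ m.+1) = (dot (E *m f) (E *m f) ^+ (2 ^ m)) ^+ 2.
    by rewrite -exprM expnSr.
  have ->: dot f f ^+ (2 * (2 ^ m).-1).+1 = (dot f f ^+ (2 ^ m).-1) ^+ 2 * dot f f.
    by rewrite exprSr mulnC exprM.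
  rewrite -mulrA.
  apply: le_trans (_ : (dot f f ^+ (2 ^ m).-1 *
    dot (iter (2 ^ m) (mulmx E) f) (iter (2 ^ m) (mulmx E) f)) ^+ 2 <= _).
    by rewrite lerXn2r ?nnegrE ?mulr_ge0 ?exprn_ge0 ?dot_ge0.
  rewrite exprMn ler_wpM2l ?sqr_ge0 //.
  by rewrite expnS; exact: q2.
have tr : dot (iter (2 ^ p) (mulmx E) f) (iter (2 ^ p) (mulmx E) f) <=
    dot f f * B ^+ (2 ^ p).
  apply: le_trans (ler_wpM2l (dot_ge0 f) trB).
  rewrite mulr_sumr dotE; apply: ler_sum => i _.
  by rewrite -expr2 -dot_delta adj cauchy_schwarz.
have := le_trans (qp p) (ler_wpM2l _ tr).
rewrite exprn_ge0 ?dot_ge0 // => /(_ isT).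
rewrite mulrA -exprSr prednK ?expn_gt0 // -exprMn mulrC => H.
by rewrite -(ler_pXn2r (n := 2 ^ p)) ?nnegrE ?mulr_ge0 ?dot_ge0 ?expn_gt0.
Qed.

(** The Rayleigh quotient has a maximiser z on the compact unit sphere. The form
    q = mu |x| ^ 2 - x M x is then nonnegative and vanishes at z, so its
    derivative at z in the direction y = mu z - M z, which is 2 |y| ^ 2, must
    vanish. *)
Lemma max_rayleigh_eigenvalue K (M : 'M[R]_K) : (0 < K)%N -> M^T = M ->
  exists2 mu, eigenvalue M mu & forall x : 'cV[R]_K, dot x (M *m x) <= mu * dot x x.
Proof.
move=> K0 symM.
pose f (v : 'rV[R]_K) : R := dot v^T (M *m v^T).
pose S : set 'rV[R]_K := [set v | dot v^T v^T = 1]%classic.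
have cdot (A : 'M[R]_K) : continuous (fun v : 'rV[R]_K => dot v^T (A *m v^T)).
  have -> : (fun v : 'rV[R]_K => dot v^T (A *m v^T)) =
      (fun v => \sum_i v 0 i * \sum_j A i j * v 0 j).
    apply: funext => v; rewrite dotE; apply: eq_bigr => i _.
    by rewrite !mxE; congr (_ * _); apply: eq_bigr => j _; rewrite mxE.
  apply: continuous_big => [|i _ v]; first exact: add_continuous.
  apply: (@cvgM _ _ (nbhs v)); first exact: (@coord_continuous _ _ _ 0 i v).
  have cs : continuous (fun x : 'rV[R]_K => \sum_j A i j * x 0 j); last exact: (cs v).
  apply: continuous_big => [|j _ u]; first exact: add_continuous.
  by apply: (@cvgMl_tmp _ _ (nbhs u)); exact: (@coord_continuous _ _ _ 0 j u).
have Sne : (S !=set0)%classic.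
  exists (delta_mx 0 (Ordinal K0)); rewrite /S /= trmx_delta dot_delta.
  by rewrite mxE !eqxx.
have Scl : closed S.
  have -> : S = ((fun v : 'rV[R]_K => dot v^T (1%:M *m v^T)) @^-1` [set 1])%classic.
    by apply/seteqP; split => v; rewrite /S /= mul1mx.
  apply: preimage_closed; last exact: closed_eq.
  by move=> v _; exact: cdot.
have Sbd : bounded_set S.
  exists 1; split; rewrite ?num_real // => m m1 v /= Sv.
  rewrite [leLHS]/Num.Def.normr /= mx_normrE; apply: bigmax_le => /= [|[i j] _ /=].
    by apply: ltW; apply: lt_trans m1.
  apply: ltW; apply: le_lt_trans m1.
  rewrite ord1 -(expr_le1 (n := 2)) ?normr_ge0 // real_normK ?num_real //.
  by have := sqr_entry_le_dot v^T j; rewrite Sv mxE.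
have [v vS vmax] := EVT_max_rV Sne (bounded_closed_compact Sbd Scl)
  (continuous_subspaceT (cdot M)).
move: vS; rewrite inE /S /= => vv.
set mu := dot v^T (M *m v^T).
have ray (x : 'cV[R]_K) : dot x (M *m x) <= mu * dot x x.
  have [x0|x0] := eqVneq (dot x x) 0.
    by rewrite (dot_eq0 x0) mulmx0 /dot !mulmx0 mxE mulr0.
  have xp : 0 < dot x x by rewrite lt_def x0 dot_ge0.
  have s0 : 0 < Num.sqrt (dot x x) by rewrite sqrtr_gt0.
  have := vmax ((Num.sqrt (dot x x))^-1 *: x^T).
  rewrite inE /S /= /f linearZ /= trmxK -scalemxAr !(dotZl, dotZr) mulrA -invfM.
  rewrite -expr2 sqr_sqrtr ?dot_ge0 // mulVf // => /(_ erefl).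
  by rewrite mulrA -invfM -expr2 sqr_sqrtr ?dot_ge0 // ler_pdivrMl // mulrC.
exists mu => //.
set z := v^T in vv mu ray *.
suff Mz : M *m z = mu *: z.
  apply/eigenvalueP; exists z^T; first by rewrite -{1}symM -trmx_mul Mz linearZ.
  apply/eqP => z0; have := vv; rewrite -(trmxK z) z0 trmx0 /dot mulmx0 mxE => /eqP.
  by rewrite eq_sym oner_eq0.
have [y yE] : exists y, y = mu *: z - M *m z by exists (mu *: z - M *m z).
have yz : dot y y = mu * dot y z - dot y (M *m z) by rewrite {2}yE dotBr dotZr.
pose q (x : 'cV[R]_K) := mu * dot x x - dot x (M *m x).
have q0 x : 0 <= q x by rewrite subr_ge0.
have qE t : q (z + t *: y) = t ^+ 2 * q y + 2 * t * dot y y.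
  have zMy : dot z (M *m y) = dot y (M *m z) by rewrite dotC dot_mulmxl symM.
  rewrite yz /q mulmxDr -scalemxAr !(dotDl, dotDr, dotZl, dotZr) zMy.
  rewrite (dotC z y).
  by rewrite -/mu vv; ring.
apply/eqP; rewrite eq_sym -subr_eq0; apply/eqP/dot_eq0; rewrite -yE.
apply/eqP; rewrite eq_le dot_ge0 andbT leNgt; apply/negP => yp.
have [qy0|qy0] := eqVneq (q y) 0.
  by have := q0 (z + (-1) *: y); rewrite qE qy0; lra.
have qyp : 0 < q y by rewrite lt_def qy0 q0.
(* this step minimises the parabola t |-> q (z + t y) *)
have := q0 (z + (- (dot y y / q y)) *: y); rewrite qE.
have -> : (- (dot y y / q y)) ^+ 2 * q y + 2 * - (dot y y / q y) * dot y y =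
  - (dot y y ^+ 2 / q y) by field.
by rewrite oppr_ge0 leNgt divr_gt0 // exprn_gt0.
Qed.

End InnerProduct.

Section EuclideanNorm.
Variables (R : realType) (m : nat).
Implicit Types u v : 'rV[R]_m.

Lemma norm2E v : norm2 v = Num.sqrt (dot v^T v^T).
Proof.
by congr (Num.sqrt _); rewrite dotE; apply: eq_bigr => j _; rewrite mxE expr2.
Qed.

Lemma norm2_ge0 v : 0 <= norm2 v.
Proof. exact: sqrtr_ge0. Qed.

Lemma sqr_norm2 v : norm2 v ^+ 2 = dot v^T v^T.
Proof. by rewrite norm2E sqr_sqrtr ?dot_ge0. Qed.

Lemma norm2N v : norm2 (- v) = norm2 v.
Proof. by congr (Num.sqrt _); apply: eq_bigr => j _; rewrite mxE sqrrN. Qed.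

Lemma norm2_triangle u v : norm2 (u + v) <= norm2 u + norm2 v.
Proof.
rewrite -ler_sqr ?nnegrE ?addr_ge0 ?norm2_ge0 // sqr_norm2 linearD /=.
rewrite !(dotDl, dotDr) (dotC v^T) sqrrD !sqr_norm2.
suff : dot u^T v^T <= norm2 u * norm2 v by lra.
apply: le_trans (ler_norm _) _.
rewrite -ler_sqr ?nnegrE ?mulr_ge0 ?norm2_ge0 // real_normK ?num_real //.
by rewrite exprMn !sqr_norm2 cauchy_schwarz.
Qed.

Lemma norm2_distC u v : norm2 (u - v) = norm2 (v - u).
Proof. by rewrite -norm2N opprB. Qed.

Lemma norm2_dist_triangle u v w : norm2 (u - w) <= norm2 (u - v) + norm2 (v - w).
Proof. by apply: le_trans (norm2_triangle _ _); rewrite addrA subrK. Qed.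

Lemma norm2_le_entries v a : 0 <= a -> (forall j, `|v 0 j| <= a) ->
  norm2 v <= m%:R * a.
Proof.
move=> a0 va.
have h (w : 'rV[R]_m) : norm2 w <= \sum_j `|w 0 j|.
  rewrite -ler_sqr ?nnegrE ?norm2_ge0 ?sumr_ge0 // sqr_norm2 dotE.
  rewrite expr2 mulr_suml; apply: ler_sum => j _; rewrite mxE.
  rewrite -expr2 -real_normK ?num_real // expr2 ler_wpM2l // (bigD1 j) //=.
  by rewrite lerDl sumr_ge0.
apply: le_trans (h v) _.
apply: (@le_trans _ _ (\sum_(j < m) a)); first exact: ler_sum.
by rewrite sumr_const card_ord mulr_natl.
Qed.
End EuclideanNorm.

Lemma sum_norm_entries_le (R : realType) n (u : 'cV[R]_n) : dot u u <= 1 ->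
  \sum_c `|u c 0| <= Num.sqrt n%:R.
Proof.
move=> u1.
have := cauchy_schwarz (\col_c `|u c 0|) (const_mx 1 : 'cV[R]_n).
rewrite [dot _ (const_mx 1)]dotE (eq_bigr (fun c => `|u c 0|)) => [|c _]; last by rewrite !mxE mulr1.
have -> : dot (\col_c `|u c 0|) (\col_c `|u c 0|) = dot u u.
  by rewrite !dotE; apply: eq_bigr => c _; rewrite !mxE -!expr2 real_normK ?num_real.
have -> : dot (const_mx 1) (const_mx 1 : 'cV[R]_n) = n%:R.
  rewrite dotE (eq_bigr (fun=> 1)) => [|c _]; last by rewrite !mxE mulr1.
  by rewrite sumr_const card_ord.
move=> H; rewrite -ler_sqr ?nnegrE ?sqrtr_ge0 ?sumr_ge0 // sqr_sqrtr //.
by apply: le_trans H _; rewrite ler_piMl.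
Qed.

Lemma kernel_vector (R : realType) m m' (G : 'M[R]_(m, m')) : (m' < m)%N ->
  exists2 z : 'rV[R]_m, z != 0 & z *m G = 0.
Proof.
move=> mm; have : kermx G != 0.
  rewrite -mxrank_eq0 mxrank_ker subn_eq0 -ltnNge.
  exact: leq_ltn_trans (rank_leq_col G) mm.
case/rowV0Pn => z zG z0; exists z => //; exact/sub_kermxP.
Qed.

(** * Laplacians and eigenbases *)

Section LaplacianForms.
Variable R : realType.

Lemma laplacian_mulE n (M : 'M[R]_n) (f : 'cV[R]_n) a :
  (laplacian M *m f) a 0 = \sum_c M a c * (f a 0 - f c 0).
Proof.
rewrite /laplacian mulmxBl mxE [in X in _ + X]mxE mul_diag_mx !mxE.
by rewrite mulr_suml -sumrB; apply: eq_bigr => c _; rewrite mulrBr.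
Qed.

Lemma laplacian_tr n (M : 'M[R]_n) : M^T = M -> (laplacian M)^T = laplacian M.
Proof. by move=> symM; rewrite /laplacian linearB /= tr_diag_mx symM. Qed.

Lemma laplacian_offdiag n (M M' : 'M[R]_n) :
  (forall i j, i != j -> M i j = M' i j) -> laplacian M = laplacian M'.
Proof.
move=> MM; apply/matrixP => i j; rewrite !mxE.
case: eqVneq => [<-|ij]; last by rewrite !mulr0n MM.
rewrite !mulr1n (bigD1 i) //= [in RHS](bigD1 i) //= addrAC subrr add0r.
rewrite [RHS]addrAC subrr add0r.
by apply: eq_bigr => c ci; rewrite MM // eq_sym.
Qed.

Lemma laplacianB n (M M' : 'M[R]_n) : laplacian (M - M') = laplacian M - laplacian M'.
Proof.
apply/matrixP => i j; rewrite !mxE.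
under eq_bigr do rewrite !mxE.
by rewrite sumrB; case: (i == j); rewrite ?mulr1n ?mulr0n; ring.
Qed.

Lemma laplacian_form n (M : 'M[R]_n) (x : 'cV[R]_n) : M^T = M ->
  dot x (laplacian M *m x) =
  2^-1 * \sum_a \sum_c M a c * (x a 0 - x c 0) ^+ 2.
Proof.
move=> symM; have M_sym a c : M a c = M c a by rewrite -{1}symM mxE.
have e1 : dot x (laplacian M *m x) =
    \sum_a \sum_c M a c * (x a 0 * (x a 0 - x c 0)).
  rewrite dotE; apply: eq_bigr => a _; rewrite laplacian_mulE mulr_sumr.
  by apply: eq_bigr => c _; ring.
have e2 : dot x (laplacian M *m x) =
    \sum_a \sum_c M a c * (x c 0 * (x c 0 - x a 0)).
  rewrite e1 exchange_big /=; apply: eq_bigr => a _; apply: eq_bigr => c _.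
  by rewrite M_sym.
have : dot x (laplacian M *m x) + dot x (laplacian M *m x) =
    \sum_a \sum_c M a c * (x a 0 - x c 0) ^+ 2.
  rewrite {1}e1 e2 -big_split /=; apply: eq_bigr => a _.
  by rewrite -big_split /=; apply: eq_bigr => c _; ring.
by move=> <-; lra.
Qed.

Section EigenBasis.
Variables (n : nat) (M W : 'M[R]_n) (lam : 'rV[R]_n).
Hypothesis W_orth : W^T *m W = 1%:M.
Hypothesis W_eigen : M *m W = W *m diag_mx lam.

Lemma dot_coords (x y : 'cV[R]_n) : dot x y = \sum_j dot (col j W) x * dot (col j W) y.
Proof.
have e (z : 'cV[R]_n) j : dot (col j W) z = (W^T *m z) j 0.
  by rewrite dotE mxE; apply: eq_bigr => i _; rewrite !mxE.
have -> : dot x y = dot (W^T *m x) (W^T *m y).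
  by rewrite dot_mulmxl trmxK mulmxA (mulmx1C W_orth) mul1mx.
by rewrite dotE; apply: eq_bigr => j _; rewrite !e.
Qed.

Lemma eigen_col j : M *m col j W = lam 0 j *: col j W.
Proof.
apply/matrixP => i k; transitivity ((M *m W) i j).
  by rewrite !mxE; apply: eq_bigr => l _; rewrite mxE.
by rewrite W_eigen mul_mx_diag !mxE mulrC.
Qed.

Lemma dot_col_col i j : dot (col i W) (col j W) = (i == j)%:R.
Proof.
rewrite dotE; transitivity ((W^T *m W) i j); last by rewrite W_orth mxE.
by rewrite mxE; apply: eq_bigr => k _; rewrite !mxE.
Qed.

Lemma form_coords x : M^T = M ->
  dot x (M *m x) = \sum_j lam 0 j * dot (col j W) x ^+ 2.
Proof.
move=> symM; rewrite dot_coords; apply: eq_bigr => j _.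
rewrite (dotC _ (M *m x)) dot_mulmxl symM eigen_col dotZr (dotC x).
by ring.
Qed.

End EigenBasis.
End LaplacianForms.

(** * Moments of the Laplacian of a centred random graph *)

Section BlockWords.
Variables (R : realType) (n K : nat) (label : 'I_n -> 'I_K).

Definition block_proj (r : 'I_K) : 'M[R]_n := diag_mx (\row_i (label i == r)%:R).

Lemma block_projE r (f : 'cV[R]_n) a :
  (block_proj r *m f) a 0 = (label a == r)%:R * f a 0.
Proof. by rewrite mul_diag_mx !mxE. Qed.

(** The vector E 1_(r1) E 1_(r2) ... E 1_(rj) 1 for s = r1 :: r2 :: ... :: rj. *)
Fixpoint block_word (E : 'M[R]_n) (s : seq 'I_K) : 'cV[R]_n :=
  if s is r :: s' then E *m (block_proj r *m block_word E s') else const_mx 1.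

Fixpoint words (j : nat) : seq (seq 'I_K) :=
  if j is j'.+1 then [seq r :: s | r <- enum 'I_K, s <- words j'] else [:: [::]].

Lemma size_words j : size (words j) = (K ^ j)%N.
Proof.
by elim: j => //= j IH; rewrite size_allpairs size_enum_ord IH expnS.
Qed.

Lemma mem_words j s : s \in words j -> size s = j.
Proof.
elim: j s => [|j IH] s /=; first by rewrite inE => /eqP ->.
by case/allpairsP => -[r t] /= [_ /IH <- ->].
Qed.

End BlockWords.

Section NoiseWalks.
Variables (R : realType) (n K : nat) (label : 'I_n -> 'I_K).
Variable p : 'I_n * 'I_n -> R.

Definition unordered_pair (i j : 'I_n) := if (i < j)%N then (i, j) else (j, i).

Lemma unordered_pairC i j : unordered_pair i j = unordered_pair j i.
Proof.
rewrite /unordered_pair; case: (ltngtP i j) => // ij.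
by have -> : i = j by apply: val_inj.
Qed.

Lemma unordered_pair_inj v : injective (unordered_pair v).
Proof.
by move=> c c'; rewrite /unordered_pair; case: ifP; case: ifP => _ _ [] // -> ->.
Qed.

Local Notation walk_poly := (walk_poly p unordered_pair).
Local Notation config := {ffun 'I_n * 'I_n -> bool}.

Definition noise (w : config) : 'M[R]_n :=
  \matrix_(i, j) centred p w (unordered_pair i j).
Definition noise_laplacian w := laplacian (noise w).

Lemma noise_laplacian_tr w : (noise_laplacian w)^T = noise_laplacian w.
Proof.
apply: laplacian_tr; apply/matrixP => i j.
by rewrite !mxE unordered_pairC.
Qed.

(** The entry a of E f is the sum over c of the noise at the edge between a and c,
    times f a - f c: the walk goes along that edge and then either returns to a or
    stays at c, which accounts for the factor 2. *)
Lemma noise_walk m C (f : config -> 'cV[R]_n) :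
  (forall a, walk_poly m C (fun w => f w a 0)) ->
  forall a, walk_poly m.+1 (2 * C) (fun w => (noise_laplacian w *m f w) a 0).
Proof.
move=> Hf a; rewrite mulr2n mulrDl mul1r.
have Hn c : walk_poly m C (fun w => - f w c 0).
  rewrite -[C]mul1r; apply: Walk_eq (walk_poly_scale (a := -1) _ (Hf c)) => [w|].
    by rewrite mulN1r.
  by rewrite normrN1.
apply: Walk_eq (Walk_add (Walk_step a (fun=> Hf a)) (Walk_step a Hn)) => w.
rewrite laplacian_mulE -big_split /=; apply: eq_bigr => c _.
by rewrite mxE -mulrDr.
Qed.

Lemma block_word_walk s a :
  walk_poly (size s) (2 ^+ size s) (fun w => block_word label (noise_laplacian w) s a 0).
Proof.
elim: s a => [|r s IH] a /=.
  apply: Walk_eq (Walk_stop _ _ (_ : `|1| <= 1)) => [w|]; first by rewrite mxE.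
  by rewrite normr1.
rewrite exprS; apply: noise_walk => {}a.
rewrite -[2 ^+ _]mul1r; apply: Walk_eq (walk_poly_scale (a := (label a == r)%:R) _ (IH a)) => [w|].
  by rewrite block_projE.
by case: eqP; rewrite ?normr1 ?normr0.
Qed.

Lemma iter_walk k i a :
  walk_poly k (2 ^+ k) (fun w => iter k (mulmx (noise_laplacian w)) (delta_mx i (0 : 'I_1)) a 0).
Proof.
elim: k a => [|k IH] a.
  apply: (Walk_eq (Y := fun=> (delta_mx i 0 : 'cV[R]_n) a 0)) => //.
  by apply: Walk_stop; rewrite mxE; case: (_ && _); rewrite ?normr1 ?normr0.
by rewrite exprS; apply: noise_walk.
Qed.

(** The two senses in which the noise has to be small: as an operator, and entry by
    entry on all words of length at most k. *)
Definition small_noise (k : nat) (b : R) (E : 'M[R]_n) : Prop :=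
  (forall f : 'cV[R]_n, dot (E *m f) (E *m f) <= b ^+ 2 * dot f f) /\
  (forall j s a, (j <= k)%N -> s \in words K j ->
     `|block_word label E s a 0| <= b ^+ j).

Hypothesis p01 : forall e, 0 <= p e <= 1.
Variables (r x b : R) (l : nat).
Let k := (2 ^ l)%N.
Hypothesis p_le : forall e, p e <= r.
Hypothesis n_gt0 : (0 < n)%N.
Hypothesis nr_le : n%:R * r <= x.
Hypothesis k_le : (2 * k)%:R <= x.
Hypothesis b_gt0 : 0 < b.

(** A word of length j is raised to the power 2 * copies j. This is the least
    choice for which the resulting number 2 * (copies j * j) of factors is at
    least 2 * k: the moment bound decays geometrically in that number, but holds
    only as long as half of it stays below x. *)
Definition copies j := ((k + j.-1) %/ j)%N.

Lemma copies_bounds j : (0 < j <= k)%N -> (k <= copies j * j <= 2 * k)%N.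
Proof.
move=> /andP[j0 jk]; rewrite /copies.
have := leq_trunc_div (k + j.-1) j; have := ltn_ceil (k + j.-1) j0.
rewrite mulSn; lia.
Qed.

Lemma copies_gt0 j : (0 < j <= k)%N -> (0 < copies j)%N.
Proof.
move=> jk; have := copies_bounds jk; have := expn_gt0 2 l; rewrite -/k.
by case: (copies j) => //; lia.
Qed.

(** The factor 4 ^ m is the branching 2 of noise_walk over 2 * m steps; together
    with the 4 * x * m of walk_moment_le and m <= 2 * k it gives the constant 32. *)
Lemma walk_moment_ratio m Y : (0 < m)%N -> (m <= 2 * k)%N ->
  walk_poly (2 * m) (4 ^+ m) Y ->
  `|expect p Y| / b ^+ (2 * m) <= (32 * x * k%:R / b ^+ 2) ^+ m.
Proof.
move=> m0 mk H; have x0 : 0 <= x by apply: le_trans k_le.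
have mx : m%:R <= x by apply: le_trans k_le; rewrite ler_nat.
have := walk_moment_le p01 p_le unordered_pair_inj H mx nr_le n_gt0 => Hm.
rewrite exprM expr_div_n ler_pM2r ?invr_gt0 ?exprn_gt0 //.
apply: le_trans Hm _; rewrite -exprMn lerXn2r ?nnegrE ?mulr_ge0 //.
have : m%:R <= 2 * k%:R :> R by rewrite -natrM ler_nat.
by move/(ler_wpM2l x0); lra.
Qed.

(** The functional to which Markov's inequality is applied: it is at least 1 as
    soon as the noise is not small. The first sum is the normalised trace of the
    power 2 * k of the noise Laplacian. *)
Definition noise_excess w : R :=
  \sum_i iter (2 * k) (mulmx (noise_laplacian w)) (delta_mx i (0 : 'I_1)) i 0 / b ^+ (2 * k) +
  \sum_(j < k) \sum_(s <- words K j.+1) \sum_a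
     block_word label (noise_laplacian w) s a 0 ^+ (2 * copies j.+1)
       / b ^+ (2 * (copies j.+1 * j.+1)).

Lemma noise_power_dot w i :
  iter (2 * k) (mulmx (noise_laplacian w)) (delta_mx i (0 : 'I_1)) i 0 =
  dot (iter k (mulmx (noise_laplacian w)) (delta_mx i (0 : 'I_1)))
      (iter k (mulmx (noise_laplacian w)) (delta_mx i (0 : 'I_1))).
Proof.
rewrite dot_iter_mulmx ?noise_laplacian_tr //.
by rewrite -iterD addnn -mul2n dotC dot_delta.
Qed.

Lemma noise_excess_terms w :
  [/\ 0 <= \sum_i iter (2 * k) (mulmx (noise_laplacian w)) (delta_mx i (0 : 'I_1)) i 0 / b ^+ (2 * k)
    & forall j s a, 0 <= block_word label (noise_laplacian w) s a 0 ^+ (2 * copies j)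
       / b ^+ (2 * (copies j * j))].
Proof.
split=> [|j s a].
  by rewrite sumr_ge0 // => i _; rewrite noise_power_dot divr_ge0 ?dot_ge0 ?exprn_ge0 ?ltW.
apply: divr_ge0; last by rewrite exprn_ge0 // ltW.
by rewrite exprM exprn_ge0 // sqr_ge0.
Qed.

Lemma noise_excess_ge0 w : 0 <= noise_excess w.
Proof.
have [h1 h2] := noise_excess_terms w.
by rewrite addr_ge0 // sumr_ge0 // => j _; rewrite sumr_ge0 // => s _; rewrite sumr_ge0.
Qed.

Lemma small_noise_of_excess w : noise_excess w < 1 ->
  small_noise k b (noise_laplacian w).
Proof.
move=> ex1; have [h1 h2] := noise_excess_terms w.
have h3 : 0 <= noise_excess w - \sum_i iter (2 * k) (mulmx (noise_laplacian w)) (delta_mx i (0 : 'I_1)) i 0 / b ^+ (2 * k).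
  rewrite /noise_excess addrC addKr.
  by rewrite sumr_ge0 // => j _; rewrite sumr_ge0 // => s _; rewrite sumr_ge0.
split.
  apply: (opnorm_le_of_trace_power (p := l)).
  - exact: noise_laplacian_tr.
  - exact: sqr_ge0.
  rewrite -exprM -/k.
  under eq_bigr do rewrite -noise_power_dot.
  move: h3; rewrite subr_ge0 -mulr_suml ler_pdivrMr ?exprn_gt0 // => h3.
  by apply: le_trans h3 _; rewrite ger_pMl ?exprn_gt0 // ltW.
move=> [|j] s a jk sj.
  by move: sj; rewrite inE => /eqP ->; rewrite mxE normr1.
have : block_word label (noise_laplacian w) s a 0 ^+ (2 * copies j.+1)
       / b ^+ (2 * (copies j.+1 * j.+1)) <= 1.
  apply: ltW; apply: le_lt_trans ex1.
  rewrite /noise_excess -[leLHS]add0r lerD //.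
  rewrite (bigD1 (Ordinal jk)) //= -[leLHS]addr0 lerD //; last first.
    by rewrite sumr_ge0 // => i _; rewrite sumr_ge0 // => t _; rewrite sumr_ge0.
  rewrite (big_rem s) //= -[leLHS]addr0 lerD //; last first.
    by rewrite sumr_ge0 // => t _; rewrite sumr_ge0.
  by rewrite (bigD1 a) //= lerDl sumr_ge0.
rewrite ler_pdivrMr ?exprn_gt0 // mul1r.
have -> : b ^+ (2 * (copies j.+1 * j.+1)) = (b ^+ j.+1) ^+ (2 * copies j.+1).
  by rewrite -exprM; congr (_ ^+ _); lia.
rewrite [X in X <= _]exprM -real_normK ?num_real // -(exprM `|_|).
by rewrite ler_pXn2r ?nnegrE ?exprn_ge0 ?(ltW b_gt0) // muln_gt0 /= copies_gt0.
Qed.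

Lemma expect_noise_excess_le : (0 < K)%N -> 32 * x * k%:R / b ^+ 2 <= 1 ->
  expect p noise_excess <= n%:R * (2 * K%:R * (32 * x * k%:R / b ^+ 2)) ^+ k.
Proof.
move=> K0; set th := 32 * x * k%:R / b ^+ 2 => th1.
have x0 : 0 <= x by apply: le_trans k_le.
have k0 : (0 < k)%N by rewrite expn_gt0.
have e4 : 2 ^+ 2 = 4 :> R by rewrite -natrX.
have th0 : 0 <= th by rewrite !mulr_ge0 ?invr_ge0 ?exprn_ge0 ?(ltW b_gt0).
have trace_le : \sum_(i < n) expect p (fun w =>
    iter (2 * k) (mulmx (noise_laplacian w)) (delta_mx i (0 : 'I_1)) i 0
      / b ^+ (2 * k)) <= n%:R * th ^+ k.
  apply: (@le_trans _ _ (\sum_(i < n) th ^+ k)); last by rewrite sumr_const card_ord mulr_natl.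
  apply: ler_sum => i _; apply: le_trans (ler_norm _) _.
  under eq_expect do rewrite mulrC.
  rewrite expectZ normrM mulrC [X in _ * X]ger0_norm ?invr_ge0 ?exprn_ge0 ?(ltW b_gt0) //.
  apply: walk_moment_ratio => //; first by lia.
  by have := iter_walk (2 * k) i i; rewrite exprM e4.
have word_le (j : 'I_k) s a : s \in words K j.+1 ->
    expect p (fun w => block_word label (noise_laplacian w) s a 0 ^+ (2 * copies j.+1)
       / b ^+ (2 * (copies j.+1 * j.+1))) <= th ^+ k.
  move=> sj; have /andP[c1 c2] := copies_bounds (ltn_ord j : 0 < j.+1 <= k)%N.
  have c0 := copies_gt0 (ltn_ord j : 0 < j.+1 <= k)%N.
  apply: (@le_trans _ _ (th ^+ (copies j.+1 * j.+1))); last by rewrite ler_wiXn2l.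
  apply: le_trans (ler_norm _) _.
  under eq_expect do rewrite mulrC.
  rewrite expectZ normrM mulrC [X in _ * X]ger0_norm ?invr_ge0 ?exprn_ge0 ?(ltW b_gt0) //.
  apply: walk_moment_ratio => //; first by rewrite muln_gt0 c0.
  have := walk_polyX (2 * copies j.+1) (block_word_walk s a).
  rewrite (mem_words sj) -exprM -mulnA.
  have -> : (j.+1 * (2 * copies j.+1) = 2 * (copies j.+1 * j.+1))%N by lia.
  by rewrite exprM e4.
rewrite /noise_excess expectD !expect_sum.
have words_le : \sum_(j < k) expect p (fun w => \sum_(s <- words K j.+1) \sum_a
     block_word label (noise_laplacian w) s a 0 ^+ (2 * copies j.+1)
       / b ^+ (2 * (copies j.+1 * j.+1))) <= n%:R * th ^+ k * (k%:R * K%:R ^+ k).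
  apply: (@le_trans _ _ (\sum_(j < k) K%:R ^+ k * (n%:R * th ^+ k))); last first.
    by rewrite sumr_const card_ord -[leLHS]mulr_natl mulrA [leRHS]mulrC.
  apply: ler_sum => j _; rewrite expect_sum.
  apply: (@le_trans _ _ (\sum_(s <- words K j.+1) n%:R * th ^+ k)); last first.
    rewrite big_const_seq count_predT size_words iter_addr addr0 -[leLHS]mulr_natl.
    rewrite ler_wpM2r ?mulr_ge0 ?exprn_ge0 // natrX ler_weXn2l //.
    by rewrite ler1n.
  rewrite big_seq [leRHS]big_seq; apply: ler_sum => s sj; rewrite expect_sum.
  apply: (@le_trans _ _ (\sum_(a < n) th ^+ k)); last by rewrite sumr_const card_ord mulr_natl.
  by apply: ler_sum => a _; apply: word_le.
apply: le_trans (lerD trace_le words_le) _.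
have Kk : 1 <= K%:R ^+ k :> R by rewrite exprn_ege1 // ler1n.
have k2 : 1 + k%:R <= 2 ^+ k :> R.
  by rewrite -natrX -(natrD _ 1) ler_nat add1n ltn_expl.
have nT : 0 <= n%:R * th ^+ k by rewrite mulr_ge0 ?exprn_ge0.
have Kk0 := le_trans ler01 Kk.
have := ler_wpM2l nT (ler_wpM2r Kk0 k2); have := ler_wpM2l nT Kk.
rewrite [(2 * _ * th) ^+ k]exprMn [(2 * _) ^+ k]exprMn.
by move: (2 ^+ k) (K%:R ^+ k) (th ^+ k) (k%:R) => a c t m; lra.
Qed.

(** For x and b of order N, the bound is n times the k-th power of a base of order
    k / N; when k is at least log n, a small base makes it any prescribed power of
    1 / n. The factor K ^ k is the price of the union bound over all words. *)
Lemma noise_tail : (0 < K)%N -> 32 * x * k%:R / b ^+ 2 <= 1 ->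
  \sum_(w | ~~ `[< small_noise k b (noise_laplacian w) >]) weight p w <=
  n%:R * (2 * K%:R * (32 * x * k%:R / b ^+ 2)) ^+ k.
Proof.
move=> K0 th1; apply: le_trans (expect_noise_excess_le K0 th1).
apply: markov_weight => // w; first exact: noise_excess_ge0.
move=> /asboolPn bad; rewrite leNgt; apply/negP => ex1; apply: bad.
exact: small_noise_of_excess.
Qed.

End NoiseWalks.

(** * Block-constant approximation of fixed points *)

Lemma geometric_sum_le (R : realType) (q : R) m : 0 <= q -> q <= 2^-1 ->
  \sum_(j < m) q ^+ j.+1 <= 2 * q.
Proof.
move=> q0 q2; elim: m => [|m IH]; first by rewrite big_ord0 mulr_ge0.
rewrite big_ord_recl expr1.
rewrite (eq_bigr (fun j : 'I_m => q * q ^+ j.+1)) => [|j _]; last by rewrite exprS.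
by rewrite -mulr_sumr; have := ler_wpM2l q0 IH; have := ler_wpM2r q0 q2; lra.
Qed.

Section BlockExpansion.
Variables (R : realType) (n K : nat) (label : 'I_n -> 'I_K) (E : 'M[R]_n).
Variables (k : nat) (b t b0 : R) (theta y : 'I_K -> R).
Hypothesis b_ge0 : 0 <= b.
Hypothesis t_ge0 : 0 <= t.
Hypothesis b0_ge0 : 0 <= b0.
Hypothesis K_gt0 : (0 < K)%N.
Hypothesis noise_small : small_noise label k b E.
Hypothesis theta_le : forall r, `|theta r| <= t.
Hypothesis y_le : forall r, `|y r| <= b0.

Definition block_diag (f : 'I_K -> R) : 'M[R]_n := diag_mx (\row_i f (label i)).

Lemma block_diagE f (x : 'cV[R]_n) a : (block_diag f *m x) a 0 = f (label a) * x a 0.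
Proof. by rewrite mul_diag_mx !mxE. Qed.

Lemma block_diag_proj f : block_diag f = \sum_r f r *: block_proj R label r.
Proof.
apply/matrixP => i j; rewrite summxE (bigD1 (label i)) //= big1 ?addr0 => [|r ri].
  by rewrite !mxE eqxx; case: (i == j); rewrite ?mulr1n ?mulr0n ?mulr1 ?mulr0.
by rewrite !mxE eq_sym (negPf ri) mul0rn mulr0.
Qed.

Definition cons_coef (f : 'I_K -> R) (coef : seq 'I_K -> R) (s : seq 'I_K) : R :=
  if s is r :: s' then f r * coef s' else 0.

(** One more application of a scaled E turns a combination of words of length j
    into one of words of length j.+1: a block-constant scaling is a combination of
    the K block projections. *)
Lemma block_diag_words f coef j :
  E *m (block_diag f *m \sum_(s <- words K j) coef s *: block_word label E s) =
  \sum_(s <- words K j.+1) cons_coef f coef s *: block_word label E s.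
Proof.
rewrite /= big_allpairs_dep big_enum /= block_diag_proj mulmx_suml mulmx_sumr.
apply: eq_bigr => r _; rewrite -scalemxAl -scalemxAr !mulmx_sumr scaler_sumr.
by apply: eq_bigr => s _; rewrite -!scalemxAr scalerA.
Qed.

Let T := block_diag theta *m E.
Let ubar : 'cV[R]_n := block_diag y *m const_mx 1.

Lemma iter_words j : exists coef : seq 'I_K -> R,
  (forall s, `|coef s| <= t ^+ j * b0) /\
  E *m iter j (mulmx T) ubar =
  \sum_(s <- words K j.+1) coef s *: block_word label E s.
Proof.
elim: j => [|j [coef [coef_le coefE]]].
  exists (cons_coef y (fun=> 1)); split=> [[|r s]|].
  - by rewrite /= normr0 mul1r.
  - by rewrite /= mulr1 mul1r.
  by rewrite -block_diag_words /= big_seq1 scale1r.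
exists (cons_coef theta coef); split=> [[|r s]|].
- by rewrite normr0 mulr_ge0 ?exprn_ge0.
- by rewrite normrM exprS -mulrA ler_pM.
by rewrite -block_diag_words -coefE iterS -mulmxA.
Qed.

Lemma iter_ubar_le j a : (j < k)%N ->
  `|iter j.+1 (mulmx T) ubar a 0| <= b0 * (K%:R * t * b) ^+ j.+1.
Proof.
move=> jk; have [coef [coef_le coefE]] := iter_words j.
have [_ words_le] := noise_small.
rewrite iterS -mulmxA block_diagE coefE summxE normrM.
apply: (@le_trans _ _ (t * \sum_(s <- words K j.+1) t ^+ j * b0 * b ^+ j.+1)).
  apply: ler_pM => //; apply: le_trans (ler_norm_sum _ _ _) _.
  rewrite big_seq [leRHS]big_seq; apply: ler_sum => s sj.
  by rewrite mxE normrM ler_pM // words_le.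
rewrite big_const_seq count_predT size_words iter_addr addr0 -[_ *+ _]mulr_natl natrX.
rewrite !exprMn [t ^+ j.+1]exprS le_eqVlt; apply/orP; left; apply/eqP; ring.
Qed.

Lemma neumann_expansion (u : 'cV[R]_n) J : u = ubar + T *m u ->
  u = \sum_(j < J) iter j (mulmx T) ubar + iter J (mulmx T) u.
Proof.
move=> uE; elim: J => [|J IH]; first by rewrite big_ord0 add0r.
rewrite big_ord_recr /= -addrA -[X in _ = _ + (_ + X)]/(iter J.+1 (mulmx T) u) iterSr.
have iterD (v w : 'cV[R]_n) : iter J (mulmx T) v + iter J (mulmx T) w = iter J (mulmx T) (v + w).
  by elim: J {IH} => //= m <-; rewrite mulmxDr.
by rewrite iterD -uE.
Qed.

(** The remainder of the expansion involves u itself, so only the operator norm of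
    E is available for it. *)
Lemma iter_contraction (u : 'cV[R]_n) J :
  dot (iter J (mulmx T) u) (iter J (mulmx T) u) <= ((t * b) ^+ J) ^+ 2 * dot u u.
Proof.
elim: J => [|J IH]; first by rewrite !expr0 expr1n mul1r.
rewrite iterS; set v := iter J _ u in IH *.
have [opn _] := noise_small.
have h1 : dot (T *m v) (T *m v) <= t ^+ 2 * dot (E *m v) (E *m v).
  rewrite !dotE mulr_sumr; apply: ler_sum => a _; rewrite -mulmxA block_diagE.
  have : theta (label a) ^+ 2 <= t ^+ 2.
    by rewrite -[X in X <= _]real_normK ?num_real // lerXn2r ?nnegrE.
  by move/(ler_wpM2r (sqr_ge0 ((E *m v) a 0))); lra.
apply: le_trans h1 _; apply: le_trans (ler_wpM2l (sqr_ge0 t) (opn v)) _.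
have -> : ((t * b) ^+ J.+1) ^+ 2 * dot u u =
    t ^+ 2 * (b ^+ 2 * (((t * b) ^+ J) ^+ 2 * dot u u)) by rewrite [(t * b) ^+ J.+1]exprS; move: (_ ^+ J) => z; ring.
by rewrite !ler_wpM2l ?sqr_ge0.
Qed.

(** The terms of index 1 to k - 1 of the expansion of u form a geometric sum, by the
    bound on words; the remainder is at most its Euclidean length. *)
Lemma entrywise_block_approx (u : 'cV[R]_n) a : u = ubar + T *m u -> dot u u <= 1 ->
  K%:R * t * b <= 2^-1 -> (0 < k)%N ->
  `|u a 0 - y (label a)| <= 2 * (K%:R * t * b) * b0 + (K%:R * t * b) ^+ k.
Proof.
move=> uE u1 q2 k0; set q := K%:R * t * b in q2 *.
have q0 : 0 <= q by rewrite !mulr_ge0.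
have ubarE : ubar a 0 = y (label a) by rewrite block_diagE mxE mulr1.
rewrite -ubarE.
case: k k0 iter_ubar_le => // m _ it_le.
have -> : u a 0 - ubar a 0 =
    (\sum_(j < m) iter j.+1 (mulmx T) ubar) a 0 + iter m.+1 (mulmx T) u a 0.
  have := congr1 (fun x : 'cV[R]_n => x a 0) (neumann_expansion m.+1 uE).
  rewrite big_ord_recl [in RHS]mxE [in X in _ = X + _]mxE => ->.
  rewrite -[iter ord0 _ _]/ubar; ring.
apply: le_trans (ler_normD _ _) _; apply: lerD.
  rewrite summxE; apply: le_trans (ler_norm_sum _ _ _) _.
  apply: (@le_trans _ _ (\sum_(j < m) b0 * q ^+ j.+1)).
    by apply: ler_sum => j _; apply: it_le; rewrite ltnS ltnW.
  by rewrite -mulr_sumr mulrC ler_wpM2r //; exact: geometric_sum_le.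
have tb0 : 0 <= t * b by rewrite mulr_ge0.
have tbq : t * b <= q by rewrite /q -mulrA ler_peMl // ler1n.
apply: (@le_trans _ _ ((t * b) ^+ m.+1)); last by rewrite lerXn2r ?nnegrE.
rewrite -ler_sqr ?nnegrE ?exprn_ge0 // real_normK ?num_real //.
apply: le_trans (sqr_entry_le_dot _ a) _; apply: le_trans (iter_contraction _ _) _.
by rewrite ler_piMr ?sqr_ge0.
Qed.

End BlockExpansion.

(** * Recovery by K-medians *)

Section KMedians.
Variables (R : realType) (n K : nat) (label : 'I_n -> 'I_K).
Variables (X : 'M[R]_(n, K)) (mu : 'I_K -> 'rV[R]_K) (d D pm : R).
Hypothesis n_gt0 : (0 < n)%N.
Hypothesis d_gt0 : 0 < d.
Hypothesis pm_gt0 : 0 < pm.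
Hypothesis block_size : forall r, pm <= label_fraction R label r.
Hypothesis near_mu : forall i, norm2 (row i X - mu (label i)) <= d.
Hypothesis mu_sep : forall r s, r != s -> D <= norm2 (mu r - mu s).
Hypothesis D_gt : 2 * (d + d * (2 + pm^-1)) < D.

Let tau := d * (2 + pm^-1).

Lemma inf_norm2_le (i : 'I_n) (v : 'I_K -> 'rV[R]_K) r :
  inf [set norm2 (row i X - v r) | r in [set: 'I_K]]%classic <= norm2 (row i X - v r).
Proof.
apply: ge_inf; last by exists r.
by exists 0 => _ [s _ <-]; exact: norm2_ge0.
Qed.

Lemma le_inf_norm2 (i : 'I_n) (v : 'I_K -> 'rV[R]_K) a :
  (forall r, a <= norm2 (row i X - v r)) ->
  a <= inf [set norm2 (row i X - v r) | r in [set: 'I_K]]%classic.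
Proof.
move=> H; apply: lb_le_inf; last by move=> _ [s _ <-].
by exists (norm2 (row i X - v (label i))); exists (label i).
Qed.

(** The centres mu cost at most d on average. If no v were close to mu r, the
    points of the block r alone, a share of at least pm, would cost more. The
    summand 2 in tau makes the comparison strict. *)
Lemma minimizer_near_mu v r : kmedians_minimizer X v ->
  exists s, norm2 (v s - mu r) <= tau.
Proof.
move=> vmin; apply: contrapT => /forallNP H.
have := vmin mu; apply/negP; rewrite -ltNge /kmedians_cost.
rewrite ltr_pM2l ?invr_gt0 ?ltr0n //.
apply: (@le_lt_trans _ _ (n%:R * d)).
  apply: (@le_trans _ _ (\sum_(i < n) d)).
    by apply: ler_sum => i _; apply: le_trans (inf_norm2_le _ _ (label i)) _.
  by rewrite sumr_const card_ord mulr_natl.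
have far i : label i = r -> d * (1 + pm^-1) <=
    inf [set norm2 (row i X - v r) | r in [set: 'I_K]]%classic.
  move=> ir; apply: le_inf_norm2 => s.
  have := H s; move=> /negP; rewrite -ltNge /tau => ts.
  have := norm2_dist_triangle (v s) (row i X) (mu r).
  by rewrite (norm2_distC (v s) (row i X)); have := near_mu i; rewrite ir; lra.
apply: (@lt_le_trans _ _ (\sum_(i < n | label i == r) d * (1 + pm^-1))); last first.
  rewrite big_mkcond; apply: ler_sum => i _; case: eqP => [/far //|_].
  by apply: le_inf_norm2 => s; exact: norm2_ge0.
rewrite sumr_const -[ltRHS]mulr_natl.
have := block_size r; rewrite /label_fraction ler_pdivlMr ?ltr0n //.
rewrite (_ : #|[set i | label i == r]%SET| = #|[pred i | label i == r]|); last first.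
  by rewrite cardsE.
rewrite [X in _ < X%:R * _](_ : _ = #|[pred i | label i == r]|); last by apply: eq_card.
set c := #|_| => pc.
have n0 : 0 < n%:R :> R by rewrite ltr0n.
have e0 : 0 <= d * (1 + pm^-1) by rewrite mulr_ge0 ?addr_ge0 ?invr_ge0 // ltW.
apply: lt_le_trans (ler_wpM2r e0 pc).
have -> : pm * n%:R * (d * (1 + pm^-1)) = n%:R * d + pm * n%:R * d.
  by field; rewrite gt_eqF.
by rewrite ltrDl !mulr_gt0.
Qed.

Lemma kmedians_recovery v chat : kmedians_minimizer X v ->
  (forall i r, norm2 (row i X - v (chat i)) <= norm2 (row i X - v r)) ->
  exact_recovery label chat.
Proof.
move=> vmin near.
have [f fP] := choice (fun r => minimizer_near_mu r vmin).
have f_inj : injective f.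
  move=> r s frs; apply/eqP; apply: contraT => /mu_sep rs.
  have := norm2_dist_triangle (mu r) (v (f r)) (mu s).
  rewrite (norm2_distC (mu r) (v _)); have := fP r; have := fP s; rewrite frs.
  by move: D_gt d_gt0; rewrite -/tau; lra.
exists (perm f_inj) => i; rewrite permE.
have [t chat_i] : exists t, chat i = f t.
  by case: (injF_bij f_inj) => g _ gK; exists (g (chat i)); rewrite gK.
rewrite chat_i; congr (f _); apply/eqP; apply: contraT => /mu_sep ti.
have h1 := near i (f (label i)); rewrite chat_i in h1.
have h2 := near_mu i; have h3 := fP t; have h4 := fP (label i).
have h5 := norm2_dist_triangle (mu t) (v (f t)) (mu (label i)).
have h6 := norm2_dist_triangle (v (f t)) (row i X) (mu (label i)).
have h7 := norm2_dist_triangle (row i X) (mu (label i)) (v (f (label i))).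
rewrite (norm2_distC (mu t) (v (f t))) in h5.
rewrite (norm2_distC (v (f t)) (row i X)) in h6.
rewrite (norm2_distC (mu (label i)) (v (f _))) in h7.
by move: D_gt; rewrite -/tau; lra.
Qed.
End KMedians.

(** * Block models with small noise *)

Section BlockModel.
Variables (R : realType) (n K : nat) (label : 'I_n -> 'I_K) (B0 : 'M[R]_K).
Variables (rho : R) (A : 'M[R]_n).
Hypothesis n_gt0 : (0 < n)%N.
Hypothesis K_gt0 : (0 < K)%N.
Hypothesis rho_gt0 : 0 < rho.
Hypothesis B0_sym : B0^T = B0.
Hypothesis A_sym : A^T = A.
Hypothesis A_ge0 : forall i j, 0 <= A i j.

Local Notation N := (n%:R * rho).
Local Notation p := (label_fraction R label).
Local Notation L := (laplacian A).

Definition mean_mx : 'M[R]_n := \matrix_(i, j) (rho * B0 (label i) (label j)).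
Local Notation P := mean_mx.
Local Notation E := (laplacian (A - P)).

Definition block_vec (z : 'rV[R]_K) : 'cV[R]_n := \col_i z 0 (label i).
Definition block_degree (r : 'I_K) : R := \sum_s B0 r s * p s.

Lemma N_gt0 : 0 < N.
Proof. by rewrite mulr_gt0 ?ltr0n. Qed.

Lemma mean_mx_sym : P^T = P.
Proof. by apply/matrixP => i j; rewrite !mxE -{1}B0_sym mxE. Qed.

Lemma sum_by_label (F : 'I_K -> R) : \sum_i F (label i) = n%:R * \sum_r p r * F r.
Proof.
rewrite (partition_big label xpredT) //= mulr_sumr; apply: eq_bigr => r _.
rewrite (eq_bigr (fun=> F r)) => [|i /eqP -> //].
rewrite sumr_const -[LHS]mulr_natl /label_fraction mulrA mulrCA divff ?mulr1 ?pnatr_eq0 -?lt0n //.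
by congr (_%:R * _); rewrite cardsE; apply: eq_card.
Qed.

Lemma mean_degree a : \sum_c P a c = N * block_degree (label a).
Proof.
under eq_bigr do rewrite mxE.
rewrite (sum_by_label (fun s => rho * B0 (label a) s)) /block_degree !mulr_sumr.
by apply: eq_bigr => s _; ring.
Qed.

Lemma block_vec_form z :
  dot (block_vec z) (laplacian P *m block_vec z) =
  n%:R * N * (2^-1 * \sum_r \sum_s p r * p s * B0 r s * (z 0 r - z 0 s) ^+ 2).
Proof.
rewrite laplacian_form ?mean_mx_sym //.
have e a : \sum_c P a c * (block_vec z a 0 - block_vec z c 0) ^+ 2 =
    N * \sum_s p s * B0 (label a) s * (z 0 (label a) - z 0 s) ^+ 2.
  under eq_bigr do rewrite !mxE.
  rewrite (sum_by_label (fun s => rho * B0 (label a) s * (z 0 (label a) - z 0 s) ^+ 2)).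
  by rewrite !mulr_sumr; apply: eq_bigr => s _; ring.
under eq_bigr do rewrite e.
rewrite (sum_by_label (fun r => N * \sum_s p s * B0 r s * (z 0 r - z 0 s) ^+ 2)).
rewrite [RHS]mulrCA; congr (_ * _); rewrite -!mulrA; congr (_ * _).
rewrite !mulr_sumr; apply: eq_bigr => r _; rewrite !mulr_sumr.
by apply: eq_bigr => s _; ring.
Qed.

Lemma block_vec_dot z : dot (block_vec z) (block_vec z) = n%:R * \sum_r p r * z 0 r ^+ 2.
Proof.
rewrite dotE -(sum_by_label (fun r => z 0 r ^+ 2)).
by apply: eq_bigr => i _; rewrite mxE expr2.
Qed.

Lemma mean_mul_block_sum (x : 'cV[R]_n) a :
  \sum_c P a c * x c 0 =
  \sum_s rho * B0 (label a) s * \sum_(c | label c == s) x c 0.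
Proof.
rewrite (partition_big label xpredT) //=; apply: eq_bigr => s _.
by rewrite mulr_sumr; apply: eq_bigr => c /eqP cs; rewrite mxE cs.
Qed.

Variables (g1 h1 eps : R).
Hypothesis g1_ge0 : 0 <= g1.
Hypothesis eps_ge0 : 0 <= eps.
Hypothesis gap : g1 + eps < h1 - eps.
Hypothesis p_gt0 : forall r, 0 < p r.
Hypothesis B0_form : forall z : 'rV[R]_K,
  2^-1 * \sum_r \sum_s p r * p s * B0 r s * (z 0 r - z 0 s) ^+ 2 <=
  g1 * \sum_r p r * z 0 r ^+ 2.
Hypothesis degree_ge : forall r, h1 <= block_degree r.
Variable k : nat.
Hypothesis noise_small : small_noise label k (eps * N) E.

Lemma laplacian_split : L = laplacian P + E.
Proof. by rewrite laplacianB addrC subrK. Qed.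

Lemma noise_form_le x : `|dot x (E *m x)| <= eps * N * dot x x.
Proof.
have N0 := ltW N_gt0; have [opn _] := noise_small.
have b0 : 0 <= eps * N * dot x x := mulr_ge0 (mulr_ge0 eps_ge0 N0) (dot_ge0 x).
rewrite -ler_sqr ?nnegrE // real_normK ?num_real //.
apply: le_trans (cauchy_schwarz _ _) _.
apply: le_trans (ler_wpM2l (dot_ge0 x) (opn x)) _.
by rewrite le_eqVlt; apply/orP; left; apply/eqP; ring.
Qed.

Lemma block_rayleigh z :
  dot (block_vec z) (L *m block_vec z) <=
  N * (g1 + eps) * dot (block_vec z) (block_vec z).
Proof.
set x := block_vec z; rewrite laplacian_split mulmxDl dotDr.
have h1' : dot x (laplacian P *m x) <= N * g1 * dot x x.
  rewrite block_vec_form block_vec_dot.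
  have nN : 0 <= n%:R * N by rewrite mulr_ge0 ?(ltW N_gt0).
  by have := ler_wpM2l nN (B0_form z); lra.
by have := noise_form_le x; rewrite ler_norml => /andP[_]; lra.
Qed.

(** On vectors of zero sum over each block, P vanishes and only the degrees
    remain. *)
Lemma orth_rayleigh (x : 'cV[R]_n) : (forall r, \sum_(c | label c == r) x c 0 = 0) ->
  N * (h1 - eps) * dot x x <= dot x (L *m x).
Proof.
move=> xV; rewrite laplacian_split mulmxDl dotDr.
have h1' : N * h1 * dot x x <= dot x (laplacian P *m x).
  rewrite !dotE mulr_sumr; apply: ler_sum => a _; rewrite laplacian_mulE.
  have -> : \sum_c P a c * (x a 0 - x c 0) =
      \sum_c P a c * x a 0 - \sum_c P a c * x c 0.
    by rewrite -sumrB; apply: eq_bigr => c _; rewrite mulrBr.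
  rewrite mean_mul_block_sum [X in _ - X]big1; last by move=> s _; rewrite xV mulr0.
  rewrite subr0 -mulr_suml mean_degree [leRHS]mulrCA -expr2 ler_wpM2r ?sqr_ge0 //.
  by rewrite ler_wpM2l ?(ltW N_gt0).
by have := noise_form_le x; rewrite ler_norml => /andP[]; lra.
Qed.

Lemma adjacency_laplacian_psd x : 0 <= dot x (L *m x).
Proof.
rewrite laplacian_form // mulr_ge0 ?invr_ge0 // sumr_ge0 // => a _.
by rewrite sumr_ge0 // => c _; rewrite mulr_ge0 ?sqr_ge0.
Qed.

Lemma block_nonempty r : exists i, label i = r.
Proof.
have := p_gt0 r; rewrite /label_fraction.
case: (set_0Vmem [set i | label i == r]%SET) => [->|[i]].
  by rewrite cards0 mul0r ltxx.
by rewrite inE => /eqP ir _; exists i.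
Qed.

Lemma block_vec_eq0 z : dot (block_vec z) (block_vec z) = 0 -> z = 0.
Proof.
move=> /dot_eq0 z0; apply/rowP => r; have [i <-] := block_nonempty r.
by have := congr1 (fun x : 'cV[R]_n => x i 0) z0; rewrite !mxE.
Qed.

Section Spectrum.
Variables (W : 'M[R]_n) (lam : 'rV[R]_n).
Hypothesis W_orth : W^T *m W = 1%:M.
Hypothesis W_eigen : L *m W = W *m diag_mx lam.
Hypothesis lam_mono : forall i j : 'I_n, (i <= j)%N -> lam 0 i <= lam 0 j.
Hypothesis Kn : (K <= n)%N.

Let symL : L^T = L.
Proof. exact: laplacian_tr. Qed.

(** Among the block vectors, a space of dimension K, some nonzero one is orthogonal
    to the first K - 1 eigenvectors; its Rayleigh quotient is at least the K-th
    eigenvalue. *)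
Lemma low_eigenvalues (j : 'I_n) : (j < K)%N -> lam 0 j <= N * (g1 + eps).
Proof.
move=> jK.
have K1n : (K.-1 < n)%N by lia.
pose j0 := Ordinal K1n.
have jj0 : lam 0 j <= lam 0 j0 by apply: lam_mono => /=; lia.
apply: le_trans jj0 _.
have K1 : (K.-1 <= n)%N by lia.
pose G : 'M[R]_(K, K.-1) :=
  \matrix_(r, t) \sum_(i | label i == r) W i (widen_ord K1 t).
have [|z z0 zG] := kernel_vector G; first by lia.
set x := block_vec z.
have xx : 0 < dot x x.
  rewrite lt_def dot_ge0 andbT; apply: contra_neq z0; exact: block_vec_eq0.
have coord0 (t : 'I_n) : (t < K.-1)%N -> dot (col t W) x = 0.
  move=> tK; have := congr1 (fun v : 'rV[R]_(K.-1) => v 0 (Ordinal tK)) zG.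
  rewrite !mxE => <-; rewrite dotE (partition_big label xpredT) //=.
  apply: eq_bigr => r _; rewrite mxE mulr_sumr.
  apply: eq_bigr => i /eqP ir; rewrite !mxE ir mulrC; congr (_ * W _ _).
  exact: val_inj.
rewrite -(ler_pM2r xx); apply: le_trans (block_rayleigh z).
rewrite (form_coords W_orth W_eigen _ symL) (dot_coords W_orth) mulr_sumr.
apply: ler_sum => t _.
have [tK|tK] := ltnP t K.-1; first by rewrite coord0 // !(mulr0, expr0n).
by rewrite -expr2 ler_wpM2r ?sqr_ge0 // lam_mono.
Qed.

(** Some nonzero combination of the first K + 1 eigenvectors has zero sum over each
    of the K blocks; its Rayleigh quotient is at most the (K + 1)-st eigenvalue. *)
Lemma high_eigenvalues (j : 'I_n) : (K <= j)%N -> N * (h1 - eps) <= lam 0 j.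
Proof.
move=> Kj.
have K1 : (K.+1 <= n)%N by have := ltn_ord j; lia.
pose j0 : 'I_n := Ordinal K1.
have : lam 0 j0 <= lam 0 j by apply: lam_mono.
apply: le_trans.
pose G : 'M[R]_(K.+1, K) :=
  \matrix_(t, r) \sum_(i | label i == r) W i (widen_ord K1 t).
have [|y y0 yG] := kernel_vector G; first by [].
pose x : 'cV[R]_n := \sum_(t < K.+1) y 0 t *: col (widen_ord K1 t) W.
have xE i : x i 0 = \sum_t y 0 t * W i (widen_ord K1 t).
  by rewrite summxE; apply: eq_bigr => t _; rewrite !mxE.
have xV r : \sum_(c | label c == r) x c 0 = 0.
  transitivity ((y *m G) 0 r); last by rewrite yG mxE.
  under eq_bigr do rewrite xE.
  rewrite mxE exchange_big /=; apply: eq_bigr => t _.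
  by rewrite mxE mulr_sumr.
have coord (t : 'I_n) : dot (col t W) x = \sum_s y 0 s * (t == widen_ord K1 s)%:R.
  rewrite dot_sumr; apply: eq_bigr => s _.
  by rewrite dotZr (dot_col_col W_orth).
have coord_hi (t : 'I_n) : (K < t)%N -> dot (col t W) x = 0.
  move=> Kt; rewrite coord big1 // => s _; case: eqP => [ts|]; last by rewrite mulr0.
  by have := congr1 val ts => /=; have := ltn_ord s; lia.
have coord_lo s : dot (col (widen_ord K1 s) W) x = y 0 s.
  rewrite coord (bigD1 s) //= eqxx mulr1 big1 ?addr0 // => s' /negPf ss'.
  have winj : injective (widen_ord K1) by move=> s1 s2 /(congr1 val) /= /val_inj.
  by rewrite (inj_eq winj) eq_sym ss' mulr0.
have xx : 0 < dot x x.
  rewrite lt_def dot_ge0 andbT; apply: contra_neq y0 => /dot_eq0 x0.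
  by apply/rowP => s; rewrite -coord_lo x0 /dot mulmx0 !mxE.
rewrite -(ler_pM2r xx); apply: le_trans (orth_rayleigh xV) _.
rewrite (form_coords W_orth W_eigen _ symL) (dot_coords W_orth) mulr_sumr.
apply: ler_sum => t _.
have [tK|tK] := ltnP K t; first by rewrite coord_hi // !(mulr0, expr0n).
by rewrite -expr2 ler_wpM2r ?sqr_ge0 // lam_mono.
Qed.

Lemma eigenvalue_ge0 j : 0 <= lam 0 j.
Proof.
have := adjacency_laplacian_psd (col j W).
by rewrite (eigen_col W_eigen) dotZr (dot_col_col W_orth) eqxx mulr1.
Qed.

(** The part of a block vector outside the low eigenspace has energy at least
    N * (h1 - eps) per unit of squared length, and the whole vector has energy at
    most N * (g1 + eps). Since L is positive semidefinite, the part inside cannot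
    compensate. *)
Lemma block_vec_projection z :
  (1 - (g1 + eps) / (h1 - eps)) * dot (block_vec z) (block_vec z) <=
  \sum_(j < n | (j < K)%N) dot (col j W) (block_vec z) ^+ 2.
Proof.
set x := block_vec z; have hp : 0 < h1 - eps by have := gap; have := g1_ge0; have := eps_ge0; lra.
have := block_rayleigh z; rewrite -/x (form_coords W_orth W_eigen _ symL).
have dxx : dot x x = \sum_(j < n | (j < K)%N) dot (col j W) x ^+ 2 +
    \sum_(j < n | ~~ (j < K)%N) dot (col j W) x ^+ 2.
  rewrite (dot_coords W_orth) (bigID (fun j : 'I_n => (j < K)%N)) /=.
  by congr (_ + _); apply: eq_bigr => j _; rewrite expr2.
rewrite (bigID (fun j : 'I_n => (j < K)%N)) /=.
have lo : 0 <= \sum_(j < n | (j < K)%N) lam 0 j * dot (col j W) x ^+ 2.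
  by rewrite sumr_ge0 // => j _; rewrite mulr_ge0 ?sqr_ge0 ?eigenvalue_ge0.
have hi : N * (h1 - eps) * \sum_(j < n | ~~ (j < K)%N) dot (col j W) x ^+ 2 <=
    \sum_(j < n | ~~ (j < K)%N) lam 0 j * dot (col j W) x ^+ 2.
  rewrite mulr_sumr; apply: ler_sum => j; rewrite -leqNgt => Kj.
  by rewrite ler_wpM2r ?sqr_ge0 // high_eigenvalues.
move=> H; have {lo hi}H := le_trans (lerD lo hi) H; rewrite add0r in H.
rewrite -!(mulrA N) ler_pM2l ?N_gt0 // in H.
have -> : (1 - (g1 + eps) / (h1 - eps)) * dot x x =
    dot x x - (g1 + eps) * dot x x / (h1 - eps) by ring.
by rewrite {1}dxx lerBlDr lerD2l ler_pdivlMr // mulrC.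
Qed.

End Spectrum.

Variable beta : R.
Hypothesis B0_le : forall r s, `|B0 r s| <= beta.
Let kappa := (h1 - eps) - (g1 + eps).
Let q := K%:R * eps / kappa.
Hypothesis q_le : q <= 2^-1.
Hypothesis k_gt0 : (0 < k)%N.
Hypothesis q_pow : n%:R * q ^+ k <= 1.
Variable delta : R.
Hypothesis delta_gt0 : 0 < delta.
Hypothesis delta_ge : 2 * q * (beta / kappa) + (Num.sqrt n%:R)^-1 <= delta.

Local Notation sqn := (Num.sqrt (n%:R : R)).

Lemma sqn_gt0 : 0 < sqn.
Proof. by rewrite sqrtr_gt0 ltr0n. Qed.

Lemma kappa_gt0 : 0 < kappa.
Proof. by rewrite subr_gt0. Qed.

(** The eigenvector equation, solved for the diagonal part of laplacian P, is the
    fixed point equation of entrywise_block_approx. The denominators dg are at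
    least N * kappa because lam lies below the gap. *)
Lemma eigenvector_near_block (u : 'cV[R]_n) lam : dot u u = 1 ->
  L *m u = lam *: u -> lam <= N * (g1 + eps) ->
  exists m : 'I_K -> R, forall a, `|u a 0 - m (label a)| <= delta / sqn.
Proof.
move=> u1 Lu lam_le; have kp := kappa_gt0; have Np := N_gt0.
have n0 : 0 < n%:R :> R by rewrite ltr0n.
pose dg r := N * block_degree r - lam.
have dg_ge r : N * kappa <= dg r.
  have := ler_wpM2l (ltW Np) (degree_ge r).
  have := mulr_ge0 (ltW Np) eps_ge0.
  by rewrite /dg /kappa; move: lam_le; lra.
have Nk : 0 < N * kappa by rewrite mulr_gt0.
have dg_gt0 r : 0 < dg r := lt_le_trans Nk (dg_ge r).
pose S r := \sum_s rho * B0 r s * \sum_(c | label c == s) u c 0.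
pose t := (N * kappa)^-1.
have t0 : 0 <= t by rewrite invr_ge0 ltW.
have dgV r : `|(dg r)^-1| <= t.
  by rewrite ger0_norm ?invr_ge0 ?(ltW (dg_gt0 r)) // lef_pV2 ?posrE.
have beta0 : 0 <= beta by apply: le_trans (B0_le (label (Ordinal n_gt0)) (label (Ordinal n_gt0))).
have S_le r : `|S r| <= rho * beta * sqn.
  apply: (@le_trans _ _ (rho * beta * \sum_c `|u c 0|)); last first.
    by rewrite ler_wpM2l ?mulr_ge0 ?(ltW rho_gt0) ?sum_norm_entries_le ?u1.
  rewrite (partition_big label xpredT) //= mulr_sumr.
  apply: le_trans (ler_norm_sum _ _ _) _; apply: ler_sum => s _.
  rewrite normrM; apply: ler_pM => //; last exact: ler_norm_sum.
  by rewrite normrM ger0_norm ?(ltW rho_gt0) // ler_wpM2l // ltW.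
pose b0 := t * (rho * beta * sqn).
have b0_ge0 : 0 <= b0 by rewrite !mulr_ge0 ?sqrtr_ge0 // ltW.
pose y r := (dg r)^-1 * S r.
have y_le r : `|y r| <= b0 by rewrite normrM ler_pM.
have theta_le r : `|- (dg r)^-1| <= t by rewrite normrN.
have uE : u = block_diag label y *m const_mx 1 +
    (block_diag label (fun r => - (dg r)^-1) *m E) *m u.
  apply/matrixP => a j; rewrite ord1 mxE -mulmxA !block_diagE [const_mx 1 _ _]mxE mulr1.
  have := congr1 (fun x : 'cV[R]_n => x a 0) Lu.
  rewrite laplacian_split mulmxDl mxE laplacian_mulE [RHS]mxE.
  have -> : \sum_c P a c * (u a 0 - u c 0) = \sum_c P a c * u a 0 - \sum_c P a c * u c 0.
    by rewrite -sumrB; apply: eq_bigr => c _; rewrite mulrBr.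
  rewrite mean_mul_block_sum -mulr_suml mean_degree // -/(S (label a)) => H.
  have dgn := lt0r_neq0 (dg_gt0 (label a)).
  apply: (mulfI dgn); rewrite /y mulrDr !mulrA mulrN divff // mulNr !mul1r.
  by rewrite /dg; move: H; lra.
exists y => a.
have b_ge0 : 0 <= eps * N by rewrite mulr_ge0 // ltW.
have qE : K%:R * t * (eps * N) = q.
  by rewrite /q /t; field; rewrite !lt0r_neq0.
have := entrywise_block_approx b_ge0 t0 b0_ge0 K_gt0 noise_small theta_le y_le a uE.
rewrite u1 qE => /(_ (lexx _) q_le k_gt0) H; apply: le_trans H _.
have sp := sqn_gt0; rewrite ler_pdivlMr //.
apply: le_trans delta_ge.
have sq : sqn * sqn = n%:R by rewrite -expr2 sqr_sqrtr.
have b0E : b0 * sqn = beta / kappa.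
  rewrite /b0 /t -mulrA -[_ * sqn * sqn]mulrA sq; field.
  by rewrite !lt0r_neq0.
rewrite mulrDl -[2 * q * b0 * sqn]mulrA b0E lerD2l.
rewrite -(ler_pM2r sp) mulVf ?lt0r_neq0 // -mulrA sq mulrC //.
Qed.

Variables (pm sigma : R).
Hypothesis pm_gt0 : 0 < pm.
Hypothesis p_ge : forall r, pm <= p r.
Hypothesis sigma_gt0 : 0 < sigma.
Hypothesis sigma_le : sigma ^+ 2 <= 1 - (g1 + eps) / (h1 - eps).
Hypothesis delta_small :
  2 * (K%:R * delta + K%:R * delta * (2 + pm^-1)) < sigma - 2 * (K%:R * delta).

Lemma label_fraction_le1 r : p r <= 1.
Proof.
rewrite /label_fraction ler_pdivrMr ?ltr0n // mul1r ler_nat.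
by rewrite -[leqRHS](card_ord n) max_card.
Qed.

(** Let x be the normalised indicator of the block r minus that of the block s. Its
    coordinates in the low eigenspace are differences of averages of eigenvectors
    over the two blocks, hence close to the difference of the two centres, while
    block_vec_projection bounds their length from below. *)
Lemma center_separation (W : 'M[R]_n) (lam : 'rV[R]_n) (Kn : (K <= n)%N)
    (m : 'I_K -> 'I_K -> R) (r s : 'I_K) :
  W^T *m W = 1%:M -> L *m W = W *m diag_mx lam ->
  (forall i j : 'I_n, (i <= j)%N -> lam 0 i <= lam 0 j) ->
  (forall t a, `|W a (widen_ord Kn t) - m t (label a)| <= delta / sqn) ->
  r != s ->
  (sigma - 2 * (K%:R * delta)) / sqn <= norm2 (\row_t m t r - \row_t m t s).
Proof.
move=> W1 WL lam_mono near rs.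
have n0 : 0 < n%:R :> R by rewrite ltr0n.
have sp := sqn_gt0.
have pr := p_gt0 r; have ps := p_gt0 s.
have nz : n%:R != 0 :> R by rewrite lt0r_neq0.
have prz : p r != 0 by rewrite lt0r_neq0.
have psz : p s != 0 by rewrite lt0r_neq0.
pose z : 'rV[R]_K := \row_t ((t == r)%:R / (n%:R * p r) - (t == s)%:R / (n%:R * p s)).
have zr : z 0 r = (n%:R * p r)^-1.
  by rewrite mxE eqxx (negPf rs) mul0r subr0 mul1r.
have zs : z 0 s = - (n%:R * p s)^-1.
  by rewrite mxE eqxx eq_sym (negPf rs) mul0r sub0r mul1r.
have zo t : t != r -> t != s -> z 0 t = 0.
  by move=> /negPf tr /negPf ts; rewrite mxE tr ts !mul0r subr0.
have sum_z (F : 'I_K -> R) : (forall t, t != r -> t != s -> F t = 0) ->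
    \sum_t F t = F r + F s.
  move=> F0; rewrite (bigD1 r) //= (bigD1 s) ?(eq_sym s) //= big1 ?addr0 //.
  by move=> t /andP[]; exact: F0.
have := block_vec_projection W1 WL lam_mono Kn z.
rewrite (big_ord_narrow Kn) /=.
pose c : 'rV[R]_K := \row_t dot (col (widen_ord Kn t) W) (block_vec z).
have -> : \sum_(i < K) dot (col (widen_ord Kn i) W) (block_vec z) ^+ 2 =
    norm2 c ^+ 2.
  by rewrite sqr_norm2 dotE; apply: eq_bigr => t _; rewrite !mxE expr2.
move=> proj.
have xx : n%:R^-1 <= dot (block_vec z) (block_vec z).
  rewrite block_vec_dot // sum_z => [|t tr ts]; last by rewrite zo // expr0n mulr0.
  rewrite zr zs sqrrN.
  have -> : n%:R * (p r * (n%:R * p r)^-1 ^+ 2 + p s * (n%:R * p s)^-1 ^+ 2) =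
      n%:R^-1 * ((p r)^-1 + (p s)^-1) by field; rewrite nz prz psz.
  rewrite ler_peMr ?invr_ge0 ?(ltW n0) //.
  have : 1 <= (p r)^-1 by rewrite invf_ge1 // label_fraction_le1.
  have : 0 <= (p s)^-1 by rewrite invr_ge0 ltW.
  by move: (p r)^-1 (p s)^-1 => a b; lra.
have c_ge : sigma / sqn <= norm2 c.
  rewrite -ler_sqr ?nnegrE ?norm2_ge0 ?divr_ge0 ?(ltW sigma_gt0) ?(ltW sp) //.
  apply: le_trans proj; rewrite expr_div_n sqr_sqrtr //.
  by apply: ler_pM; rewrite ?sqr_ge0 ?invr_ge0.
have c_near t : `|(c - (\row_t m t r - \row_t m t s)) 0 t| <= 2 * delta / sqn.
  rewrite !mxE.
  have -> : m t r - m t s = \sum_i z 0 (label i) * m t (label i).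
    rewrite (sum_by_label (fun l => z 0 l * m t l)) sum_z => [|l lr ls].
      by rewrite zr zs; field; rewrite nz prz psz.
    by rewrite zo // mul0r mulr0.
  rewrite dotE -sumrB; apply: le_trans (ler_norm_sum _ _ _) _.
  apply: (@le_trans _ _ (\sum_i `|z 0 (label i)| * (delta / sqn))).
    apply: ler_sum => i _; rewrite !mxE mulrC -mulrBr normrM ler_wpM2l //.
  rewrite -mulr_suml (sum_by_label (fun l => `|z 0 l|)).
  rewrite sum_z => [|l lr ls]; last by rewrite zo // normr0 mulr0.
  rewrite zr zs normrN !ger0_norm ?invr_ge0 ?mulr_ge0 ?(ltW pr) ?(ltW ps) //.
  rewrite le_eqVlt; apply/orP; left; apply/eqP; field.
  by rewrite nz prz psz lt0r_neq0.
have c_tri : norm2 c <= norm2 (\row_t m t r - \row_t m t s) + K%:R * (2 * delta / sqn).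
  have d0 : 0 <= 2 * delta / sqn by rewrite divr_ge0 ?mulr_ge0 ?(ltW delta_gt0) ?(ltW sp).
  have := norm2_le_entries d0 c_near.
  have := norm2_triangle (\row_t m t r - \row_t m t s) (c - (\row_t m t r - \row_t m t s)).
  by rewrite addrC subrK; lra.
rewrite ler_pdivrMr // in c_ge; rewrite ler_pdivrMr //.
have := ler_wpM2r (ltW sp) c_tri; rewrite mulrDl.
have -> : K%:R * (2 * delta / sqn) * sqn = 2 * (K%:R * delta).
  by field; rewrite lt0r_neq0.
by move: c_ge; lra.
Qed.

Lemma deterministic_recovery chat :
  spectral_clustering_output A chat -> exact_recovery label chat.
Proof.
move=> [U [v [[Kn [W [lam [W1 WL lam_mono UW]]]] vmin near_v]]].
have UE i (t : 'I_K) : U i t = W i (widen_ord Kn t).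
  by have := congr1 (fun x : 'cV[R]_n => x i 0) (UW t (widen_ord Kn t) erefl); rewrite !mxE.
have ex t : exists m : 'I_K -> R, forall a,
    `|W a (widen_ord Kn t) - m (label a)| <= delta / sqn.
  have [||m mP] := @eigenvector_near_block (col (widen_ord Kn t) W) (lam 0 (widen_ord Kn t)) _ (eigen_col WL _).
  - by rewrite (dot_col_col W1) eqxx.
  - by apply: (low_eigenvalues W1 WL lam_mono Kn); exact: (ltn_ord t).
  by exists m => a; have := mP a; rewrite mxE.
have [m mP] := choice ex.
pose mu (r : 'I_K) : 'rV[R]_K := \row_t m t r.
have sp := sqn_gt0.
have Kp : 0 < K%:R :> R by rewrite ltr0n.
apply: (@kmedians_recovery R n K label U mu (K%:R * delta / sqn)
  ((sigma - 2 * (K%:R * delta)) / sqn) pm _ _ _ _ _ _ _ v) => //.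
- by rewrite divr_gt0 ?mulr_gt0.
- move=> i; rewrite -mulrA; apply: norm2_le_entries.
    by rewrite divr_ge0 ?(ltW delta_gt0) ?(ltW sp).
  by move=> t; rewrite !mxE UE.
- by move=> r s rs; exact: (center_separation W1 WL lam_mono mP rs).
rewrite ltr_pdivlMr //.
have -> : 2 * (K%:R * delta / sqn + K%:R * delta / sqn * (2 + pm^-1)) * sqn =
    2 * (K%:R * delta + K%:R * delta * (2 + pm^-1)).
  by field; rewrite !lt0r_neq0.
exact: delta_small.
Qed.

End BlockModel.

(** * The limiting Laplacian and approximate proportions *)

Section LimitLaplacian.
Variables (R : realType) (K : nat) (B0 : 'M[R]_K) (pi : 'rV[R]_K).
Hypothesis K_gt0 : (0 < K)%N.
Hypothesis B0_sym : B0^T = B0.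
Hypothesis pi_gt0 : forall r, 0 < pi 0 r.

(** Makes the supremum in lambda_max an upper bound. The squares of the
    eigenvalues are bounded by the largest Rayleigh quotient of M *m M. *)
Lemma symmetric_eigenvalue_bounded n (M : 'M[R]_n) : (0 < n)%N -> M^T = M ->
  exists C : R, forall a, eigenvalue M a -> `|a| <= C.
Proof.
move=> n0 symM.
have [|mu _ ray] := @max_rayleigh_eigenvalue R n (M *m M) n0; first by rewrite trmx_mul symM.
exists (1 + `|mu|) => a /eigenvalueP[v va v0].
pose u := v^T.
have Mu : M *m u = a *: u by rewrite /u -{1}symM -trmx_mul va linearZ.
have uu : 0 < dot u u.
  rewrite lt_def dot_ge0 andbT; apply: contra_neq v0 => /dot_eq0 u0.
  by rewrite -[v]trmxK -/u u0 trmx0.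
have := ray u; rewrite -mulmxA Mu -scalemxAr Mu scalerA dotZr ler_pM2r // => a2.
have [//|a1] := leP `|a| 1; first by move=> /le_trans; apply; rewrite lerDl.
have : `|a| <= `|a| ^+ 2 by rewrite expr2 ler_peMl // ltW.
have -> : `|a| ^+ 2 = a * a by rewrite -normrX ger0_norm ?sqr_ge0.
by move: a2 (ler_norm mu); lra.
Qed.

Lemma D0_mxE : D0_mx B0 pi = diag_mx (\row_r \sum_s B0 r s * pi 0 s).
Proof.
congr diag_mx; apply/rowP => r; rewrite !mxE; apply: eq_bigr => s _.
rewrite [const_mx _ _ _]mxE mulr1 mxE (bigD1 s) //= big1 ?addr0 => [|t ts].
  by rewrite mul_mx_diag !mxE eqxx mulr1n -expr2 sqr_sqrtr // ltW.
by rewrite mul_mx_diag !mxE (negPf ts) mulr0n !mul0r mulr0.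
Qed.

Definition weighted_B0 : 'M[R]_K := \matrix_(r, s) (pi 0 r * pi 0 s * B0 r s).

Lemma weighted_B0_sym : weighted_B0^T = weighted_B0.
Proof.
apply/matrixP => r s; rewrite !mxE -{1}B0_sym mxE; ring.
Qed.

Lemma laplacian_weighted_B0 :
  laplacian weighted_B0 = R0_mx pi *m L0_mx B0 pi *m R0_mx pi.
Proof.
apply/matrixP => r s.
have sq t : Num.sqrt (pi 0 t) * Num.sqrt (pi 0 t) = pi 0 t.
  by rewrite -expr2 sqr_sqrtr // ltW.
rewrite /L0_mx D0_mxE /R0_mx !mul_mx_diag !mul_diag_mx !mxE.
rewrite mulrBr mulrBl; congr (_ - _).
  case: eqVneq => [<-|_]; last by rewrite !mulr0n mulr0 mul0r.
  rewrite !mulr1n mulrAC sq mulr_sumr; apply: eq_bigr => t _; rewrite !mxE; ring.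
rewrite -[in LHS](sq r) -[in LHS](sq s); ring.
Qed.

Lemma L0_sym : (L0_mx B0 pi)^T = L0_mx B0 pi.
Proof.
rewrite /L0_mx linearB /= !trmx_mul /D0_mx /R0_mx !tr_diag_mx B0_sym.
by rewrite mulmxA.
Qed.

Lemma eigenvalue_le_lambda_max mu :
  eigenvalue (L0_mx B0 pi) mu -> `|mu| <= lambda_max (L0_mx B0 pi).
Proof.
move=> mu_eig; apply: ub_le_sup; last by exists mu.
have [C CP] := symmetric_eigenvalue_bounded K_gt0 L0_sym.
by exists C => _ [a /CP aC ->].
Qed.

(** The quadratic form of L0 at the vector of entries sqrt (pi r) * z r. As a
    sum of the nonnegative terms on the left, it is monotone in the proportions,
    which makes it comparable with the form of the observed proportions. *)
Lemma lambda_max_form (z : 'rV[R]_K) :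
  2^-1 * \sum_r \sum_s pi 0 r * pi 0 s * B0 r s * (z 0 r - z 0 s) ^+ 2 <=
  lambda_max (L0_mx B0 pi) * \sum_r pi 0 r * z 0 r ^+ 2.
Proof.
have [mu mu_eig ray] := max_rayleigh_eigenvalue K_gt0 L0_sym.
have mu_le := le_trans (ler_norm mu) (eigenvalue_le_lambda_max mu_eig).
have -> : 2^-1 * \sum_r \sum_s pi 0 r * pi 0 s * B0 r s * (z 0 r - z 0 s) ^+ 2 =
    dot z^T (laplacian weighted_B0 *m z^T).
  rewrite laplacian_form ?weighted_B0_sym //; congr (_ * _).
  by apply: eq_bigr => r _; apply: eq_bigr => s _; rewrite !mxE.
pose y := R0_mx pi *m z^T.
have R0_sym : (R0_mx pi)^T = R0_mx pi by rewrite tr_diag_mx.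
have -> : dot z^T (laplacian weighted_B0 *m z^T) = dot y (L0_mx B0 pi *m y).
  by rewrite laplacian_weighted_B0 /y dot_mulmxl R0_sym !mulmxA.
have -> : \sum_r pi 0 r * z 0 r ^+ 2 = dot y y.
  rewrite dotE; apply: eq_bigr => r _; rewrite /y mul_diag_mx !mxE.
  have : Num.sqrt (pi 0 r) ^+ 2 = pi 0 r by rewrite sqr_sqrtr // ltW.
  by move=> {1}<-; ring.
by apply: le_trans (ray y) _; rewrite ler_wpM2r ?dot_ge0.
Qed.

Lemma lambda_max_ge0 : 0 <= lambda_max (L0_mx B0 pi).
Proof.
have [mu mu_eig _] := max_rayleigh_eigenvalue K_gt0 L0_sym.
exact: le_trans (eigenvalue_le_lambda_max mu_eig).
Qed.

Lemma lambda_min_le_degree r :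
  lambda_min (D0_mx B0 pi) <= `|\sum_s B0 r s * pi 0 s|.
Proof.
apply: ge_inf; first by exists 0 => _ [a _ ->].
exists (\sum_s B0 r s * pi 0 s) => //; apply/eigenvalueP.
exists (delta_mx 0 r); last first.
  apply/eqP => /rowP/(_ r); rewrite !mxE !eqxx => /eqP; by rewrite oner_eq0.
rewrite D0_mxE; apply/rowP => s; rewrite mul_mx_diag !mxE eqxx /=.
by case: eqVneq => [->|_]; rewrite ?mul1r ?mulr1 ?mul0r ?mulr0.
Qed.

End LimitLaplacian.

Section Proportions.
Variables (R : realType) (K : nat) (B0 : 'M[R]_K) (p pi : 'I_K -> R) (eta : R).
Hypothesis B0_ge0 : forall r s, 0 <= B0 r s.
Hypothesis pi_ge0 : forall r, 0 <= pi r.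
Hypothesis eta_lt1 : eta < 1.
Hypothesis p_near : forall r, `|p r - pi r| <= eta * pi r.

Lemma proportion_bounds r : (1 - eta) * pi r <= p r <= (1 + eta) * pi r.
Proof. by have := p_near r; rewrite ler_norml => /andP[a b]; apply/andP; split; lra. Qed.

Lemma degree_proportions (h : R) r : h <= \sum_s B0 r s * pi s ->
  (1 - eta) * h <= \sum_s B0 r s * p s.
Proof.
move=> hr; apply: (@le_trans _ _ ((1 - eta) * \sum_s B0 r s * pi s)).
  by rewrite ler_wpM2l // subr_ge0 ltW.
rewrite mulr_sumr; apply: ler_sum => s _; rewrite mulrCA ler_wpM2l //.
by have /andP[] := proportion_bounds s.
Qed.

Lemma form_proportions (g g1 : R) (z : 'rV[R]_K) : 0 <= g1 ->
  (1 + eta) ^+ 2 * g <= (1 - eta) * g1 ->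
  2^-1 * \sum_r \sum_s pi r * pi s * B0 r s * (z 0 r - z 0 s) ^+ 2 <=
    g * \sum_r pi r * z 0 r ^+ 2 ->
  2^-1 * \sum_r \sum_s p r * p s * B0 r s * (z 0 r - z 0 s) ^+ 2 <=
    g1 * \sum_r p r * z 0 r ^+ 2.
Proof.
move=> g1_ge0 gg1 form.
have p_ge0 r : 0 <= p r.
  have /andP[+ _] := proportion_bounds r; apply: le_trans.
  by rewrite mulr_ge0 // subr_ge0 ltW.
have step1 : 2^-1 * \sum_r \sum_s p r * p s * B0 r s * (z 0 r - z 0 s) ^+ 2 <=
    (1 + eta) ^+ 2 * (2^-1 * \sum_r \sum_s pi r * pi s * B0 r s * (z 0 r - z 0 s) ^+ 2).
  rewrite mulrCA ler_wpM2l ?invr_ge0 // mulr_sumr; apply: ler_sum => r _.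
  rewrite mulr_sumr; apply: ler_sum => s _.
  rewrite [leRHS]mulrA ler_wpM2r ?sqr_ge0 // [leRHS]mulrA ler_wpM2r //.
  have -> : (1 + eta) ^+ 2 * (pi r * pi s) = ((1 + eta) * pi r) * ((1 + eta) * pi s) by ring.
  by have /andP[_ hr] := proportion_bounds r; have /andP[_ hs] := proportion_bounds s; rewrite ler_pM.
have piz : 0 <= \sum_r pi r * z 0 r ^+ 2.
  by rewrite sumr_ge0 // => r _; rewrite mulr_ge0 ?sqr_ge0.
have step2 : (1 - eta) * (\sum_r pi r * z 0 r ^+ 2) <= \sum_r p r * z 0 r ^+ 2.
  rewrite mulr_sumr; apply: ler_sum => r _; rewrite mulrA ler_wpM2r ?sqr_ge0 //.
  by have /andP[] := proportion_bounds r.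
apply: le_trans step1 _.
apply: le_trans (ler_wpM2l (sqr_ge0 _) form) _.
have := ler_wpM2r piz gg1; have := ler_wpM2l g1_ge0 step2.
by move: (\sum_r pi r * _) (\sum_r p r * _) => a b; lra.
Qed.

End Proportions.

Lemma uniform_positive_bound (R : realType) (K : nat) (f : 'I_K -> R) :
  (forall r, 0 < f r) -> exists2 a : R, 0 < a & forall r, a <= f r.
Proof.
move=> fp; have Sp : 0 <= \sum_r (f r)^-1.
  by rewrite sumr_ge0 // => r _; rewrite invr_ge0 ltW.
have S1 : 0 < 1 + \sum_r (f r)^-1 by rewrite ltr_pwDl.
exists (1 + \sum_r (f r)^-1)^-1; first by rewrite invr_gt0.
move=> r; rewrite -[leRHS]invrK lef_pV2 ?posrE ?invr_gt0 //.
rewrite (bigD1 r) //= addrCA lerDl addr_ge0 // sumr_ge0 // => s _.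
by rewrite invr_ge0 ltW.
Qed.

(** The length k of the expansion is a power of two, as in
    opnorm_le_of_trace_power. *)
Lemma power_of_two_between (R : realType) (x : R) : 1 <= x ->
  exists l, x <= (2 ^ l)%:R <= 2 * x.
Proof.
move=> x1.
have ex : exists l, x <= (2 ^ l)%:R.
  have [m xm] : exists m : nat, x <= m%:R.
    by exists (Num.truncn x).+1; rewrite ltW // truncnS_gt.
  by exists m; apply: le_trans xm _; rewrite ler_nat ltnW // ltn_expl.
have [[|l] lP lmin] := ex_minnP ex; [exists 0%N|exists l.+1].
  by rewrite lP /= expn0; lra.
rewrite lP /= expnS natrM ler_pM2l // leNgt; apply/negP => /ltW /lmin.
by rewrite ltnn.
Qed.

Local Open Scope classical_set_scope.
Local Open Scope ring_scope.

(** * From the random graph to a product measure *)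

Section Configurations.
Variables (R : realType) (d : measure_display) (T : measurableType d).
Variables (P : probability T R) (n K : nat) (label : 'I_n -> 'I_K).
Variables (B : 'M[R]_K) (A : 'I_n -> 'I_n -> {RV P >-> bool}).
Hypothesis B01 : forall r s, 0 <= B r s <= 1.
Hypothesis sbm : stochastic_block_model label B A.

Local Notation config := {ffun 'I_n * 'I_n -> bool}.

(** Only pairs with e.1 < e.2 carry an edge. All other pairs get probability 0, so
    that the product measure lives on all pairs and the entries i = j of the
    adjacency matrix vanish almost surely. *)
Definition edge_prob (e : 'I_n * 'I_n) : R :=
  if (e.1 < e.2)%N then B (label e.1) (label e.2) else 0.

Definition edge_config (t : T) : config :=
  [ffun e : 'I_n * 'I_n => (e.1 < e.2)%N && A e.1 e.2 t].

Lemma edge_prob01 e : 0 <= edge_prob e <= 1.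
Proof. by rewrite /edge_prob; case: ifP => // _; rewrite lexx ler01. Qed.

Lemma adjacency_mx_config t i j :
  adjacency_mx (R := R) A t i j = (edge_config t (unordered_pair i j))%:R.
Proof.
have [A_sym A_irr _ _] := sbm.
rewrite mxE ffunE /unordered_pair; case: (ltngtP i j) => ij /=.
- by rewrite ij.
- by rewrite ij A_sym.
by rewrite ij ltnn (val_inj ij) A_irr.
Qed.

Let D := [set e : 'I_n * 'I_n | (e.1 < e.2)%N]%SET.

Lemma edge_config_preimage (w : config) : (forall e, e \notin D -> ~~ w e) ->
  [set t | edge_config t = w] =
  \bigcap_(e in [set e | e \in D]) ((A e.1 e.2 : T -> bool) @^-1` [set w e]).
Proof.
move=> w0; apply/seteqP; split => t /=.
  move=> <- e /=; rewrite inE => eD; by rewrite ffunE eD.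
move=> H; apply/ffunP => e; rewrite ffunE.
have [eD|eD] := boolP (e.1 < e.2)%N; first by rewrite (H e) //= inE.
by have := w0 e; rewrite inE => /(_ eD) /negbTE ->.
Qed.

Lemma edge_config_preimage0 (w : config) e : e \notin D -> w e ->
  [set t | edge_config t = w] = set0.
Proof.
rewrite inE => /negbTE eD we; apply/seteqP; split => t //= tw.
by move: we; rewrite -tw ffunE eD.
Qed.

Lemma measurable_edge_config w : measurable [set t | edge_config t = w].
Proof.
have [/existsP[e /andP[eD we]]|/existsPn H] := boolP [exists e, (e \notin D) && w e].
  by rewrite (edge_config_preimage0 eD we); exact: measurable0.
rewrite edge_config_preimage; last by move=> e eD; have := H e; rewrite eD.
apply: fin_bigcap_measurable; first exact: finite_finset.
by move=> e _; rewrite -[X in measurable X]setTI; exact: measurable_funPT.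
Qed.

Lemma edge_config_law w : P [set t | edge_config t = w] = (weight edge_prob w)%:E.
Proof.
have [_ _ A_indep A_law] := sbm.
have [/existsP[e /andP[eD we]]|/existsPn H] := boolP [exists e, (e \notin D) && w e].
  rewrite (edge_config_preimage0 eD we) measure0 /weight (bigD1 e) //=.
  by move: eD; rewrite inE /bernoulli_pmf we /edge_prob => /negbTE ->; rewrite mul0r.
have w0 e : e \notin D -> ~~ w e by move=> eD; have := H e; rewrite eD.
rewrite edge_config_preimage // (A_indep D (fun e => [set w e])) //.
have -> : weight edge_prob w = \prod_(e in D) bernoulli_pmf (edge_prob e) (w e).
  rewrite /weight (bigID (fun e => e \in D)) /= [X in _ * X]big1 ?mulr1 //.
  move=> e eD; rewrite /bernoulli_pmf (negbTE (w0 e eD)) /edge_prob.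
  by move: eD; rewrite inE => /negbTE ->; rewrite subr0.
rewrite -prodEFin; apply: eq_bigr => e; rewrite inE => eD.
have := congr1 (fun f => f [set w e]) (A_law _ _ eD).
rewrite /distribution /pushforward => ->.
rewrite bernoulli_probE ?B01 // /bernoulli_pmf /edge_prob eD !diracE.
have memE (a b : bool) : (a \in [set b]) = (a == b) by apply/idP/eqP; rewrite inE.
by rewrite !memE; case: (w e); rewrite ?mule1 ?mule0 ?adde0 ?add0e.
Qed.

Lemma config_event (S : pred config) :
  P [set t | S (edge_config t)] = (\sum_(w | S w) weight edge_prob w)%:E.
Proof.
have -> : [set t | S (edge_config t)] =
    \bigcup_(w in [set` S]) [set t | edge_config t = w].
  apply/seteqP; split => t /=; first by move=> St; exists (edge_config t).
  by move=> [w /= Sw ->].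
have fS : finite_set [set` S] by exact: finite_finpred.
have mS w : [set` S] w -> measurable [set t | edge_config t = w].
  by move=> _; exact: measurable_edge_config.
rewrite measure_fin_bigcup //; last first.
  by move=> w w' _ _ [t [/= <- <-]].
rewrite -(@bigfs _ _ _ _ (index_enum _)) ?index_enum_uniq //; last first.
  by move=> i _; rewrite mem_index_enum.
by rewrite -sumEFin; apply: eq_bigr => w _; exact: edge_config_law.
Qed.

End Configurations.

(** * Exact recovery *)

Lemma adjacency_noise_laplacian (R : realType) (d : measure_display)
    (T : measurableType d) (P : probability T R) (n K : nat)
    (label : 'I_n -> 'I_K) (B0 : 'M[R]_K) (rho : R)
    (A : 'I_n -> 'I_n -> {RV P >-> bool}) t :
  B0^T = B0 -> stochastic_block_model label (rho *: B0) A ->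
  laplacian (adjacency_mx A t - mean_mx label B0 rho) =
  noise_laplacian (edge_prob label (rho *: B0)) (edge_config A t).
Proof.
move=> B0_sym sbm; apply: laplacian_offdiag => i j ij.
rewrite mxE (adjacency_mx_config sbm) [noise _ _ _ _]mxE /centred [X in _ + X]mxE mxE.
congr (_ - _); rewrite /edge_prob /unordered_pair.
have B0C r s : B0 r s = B0 s r by rewrite -{1}B0_sym mxE.
case: (ltngtP i j) => [lij|lji|/val_inj eij] /=.
- by rewrite lij mxE.
- by rewrite lji mxE B0C.
by rewrite eij eqxx in ij.
Qed.

(** Choice of the constant c: the base of noise_tail is of order k / N <= 2 / c. *)
Lemma tail_exponent (R : realType) (n K k : nat) (q c eps beta N : R) :
  (0 < K)%N -> 0 < eps -> 1 <= beta ->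
  128 * K%:R * beta * expR (q + 1) / eps ^+ 2 <= c ->
  (1 : R) <= ln n%:R -> c * ln n%:R <= N ->
  ln n%:R <= (k%:R : R) <= 2 * ln n%:R ->
  2 * K%:R * (32 * (N * beta) * k%:R / (eps * N) ^+ 2) <= expR (- (q + 1)).
Proof.
move=> K0 e0 b1 c_ge l1 N_ge /andP[lk k2].
have Kp : 0 < K%:R :> R by rewrite ltr0n.
have bp : 0 < beta by lra.
have e2 : 0 < eps ^+ 2 by rewrite exprn_gt0.
have Ep := expR_gt0 (q + 1).
have cp : 0 < c.
  by apply: lt_le_trans c_ge; rewrite divr_gt0 // !mulr_gt0.
have lp : 0 < ln n%:R :> R by lra.
have Np : 0 < N by apply: lt_le_trans N_ge; rewrite mulr_gt0.
have -> : 2 * K%:R * (32 * (N * beta) * k%:R / (eps * N) ^+ 2) = 64 * K%:R * beta * k%:R / (eps ^+ 2 * N).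
  by field; rewrite !lt0r_neq0.
rewrite expRN ler_pdivrMr ?mulr_gt0 // [leRHS]mulrC ler_pdivlMr //.
rewrite ler_pdivrMr // in c_ge.
have h1 := ler_wpM2r (ltW lp) c_ge.
have h2 := ler_wpM2l (ltW e2) N_ge.
have Kb : 0 <= 64 * K%:R * beta * expR (q + 1) by rewrite !mulr_ge0 // ltW.
have h3 := ler_wpM2l Kb k2.
move: h1 h2 h3; move: (eps ^+ 2) (expR _) (ln _) => a b l; lra.
Qed.

Lemma polynomial_tail (R : realType) (n k : nat) (q th : R) : (0 < n)%N ->
  0 <= q -> 0 <= th -> th <= expR (- (q + 1)) -> ln n%:R <= (k%:R : R) ->
  n%:R * th ^+ k <= n%:R `^ (- q).
Proof.
move=> n0 q0 th0 th_le lk.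
have np : 0 < n%:R :> R by rewrite ltr0n.
have h1 : th ^+ k <= expR (- (q + 1) * k%:R).
  by rewrite expRM_natr lerXn2r ?nnegrE ?expR_ge0.
have h2 : expR (- (q + 1) * k%:R) <= expR (- (q + 1) * ln n%:R).
  by rewrite ler_expR !mulNr lerN2 ler_wpM2l // addr_ge0.
apply: le_trans (ler_wpM2l (ltW np) (le_trans h1 h2)) _.
rewrite /powR gt_eqF // -{1}[n%:R](lnK (x := n%:R)) ?posrE // -expRD ler_expR; lra.
Qed.

Lemma root_decay (R : realType) (n k : nat) (x : R) : (0 < n)%N ->
  0 <= x -> x <= expR (- 1) -> ln n%:R <= (k%:R : R) -> n%:R * x ^+ k <= 1.
Proof.
move=> n0 x0 x_le lk.
have := @polynomial_tail R n k 0 x n0 (lexx _) x0.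
by rewrite add0r oppr0 powRr0; apply.
Qed.

(** The recovery event depends on t only through the configuration of edges, so it
    is measurable, whatever the spectral clustering procedure does, and its
    probability is a finite sum of weights. *)
Lemma recovery_probability_ge (R : realType) (d : measure_display)
    (T : measurableType d) (P : probability T R) (n K : nat)
    (label : 'I_n -> 'I_K) (B : 'M[R]_K) (A : 'I_n -> 'I_n -> {RV P >-> bool})
    (good : {ffun 'I_n * 'I_n -> bool} -> Prop) (tail : R) :
  (forall r s, 0 <= B r s <= 1) -> stochastic_block_model label B A ->
  (forall t, good (edge_config A t) -> exact_recovery_event label A t) ->
  \sum_(w | ~~ `[< good w >]) weight (edge_prob label B) w <= tail ->
  ((1 - tail)%:E <= P (exact_recovery_event label A))%E.
Proof.
move=> B01 sbm good_ok tail_ge.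
pose S (w : {ffun 'I_n * 'I_n -> bool}) : bool :=
  `[< forall t, edge_config A t = w -> exact_recovery_event label A t >].
have adjE t t' : edge_config A t = edge_config A t' ->
    adjacency_mx (R := R) A t = adjacency_mx A t'.
  by move=> tt'; apply/matrixP => i j; rewrite !(adjacency_mx_config sbm) tt'.
have -> : exact_recovery_event label A = [set t | S (edge_config A t)].
  apply/seteqP; split => t /=; last by move/asboolP; apply.
  move=> tP; apply/asboolP => t' /adjE tt'; rewrite /exact_recovery_event /= tt'.
  exact: tP.
rewrite (config_event B01 sbm S) lee_fin; have := sum_weight (edge_prob label B).
rewrite (bigID S) /= => sum1.
suff : \sum_(w | ~~ S w) weight (edge_prob label B) w <= tail by lra.
apply: le_trans tail_ge; rewrite [leLHS]big_mkcond [leRHS]big_mkcond.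
apply: ler_sum => w _; have w0 := weight_ge0 (edge_prob01 label B01) w.
case: ifP => [/asboolPn nS|_]; last by case: ifP.
rewrite ifT //; apply/asboolPn => gw; apply: nS => t tw.
by apply: good_ok; rewrite tw.
Qed.

Theorem theorem5p3 (R : realType) (K : nat) (B0 : 'M[R]_K) (pi : 'rV[R]_K)
    (q : R)
    (B0_sym : B0^T = B0)
    (pi_gt0 : forall r, 0 < pi 0 r)
    (pi_sum1 : \sum_(r < K) pi 0 r = 1)
    (rank_L0 : \rank (L0_mx B0 pi) = (K - 1)%N)
    (gap_L0 : lambda_max (L0_mx B0 pi) < lambda_min (D0_mx B0 pi))
    (q_gt0 : 0 < q) :
  exists c : R, 0 < c /\
  (* eps is the rate at which n_r / n converges to pi_r *)
  forall eps : nat -> R, eps @ \oo --> (0 : R) ->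
  exists n0 : nat,
  forall (n : nat) (label : 'I_n -> 'I_K) (rho : R)
    (d : measure_display) (T : measurableType d) (P : probability T R)
    (A : 'I_n -> 'I_n -> {RV P >-> bool}),
    (n0 <= n)%N ->
    (forall r, `|label_fraction R label r - pi 0 r| <= eps n) ->
    0 < rho ->
    (forall r s, 0 <= (rho *: B0) r s <= 1) ->
    stochastic_block_model label (rho *: B0) A ->
    c * ln n%:R <= n%:R * rho ->
    ((1 - n%:R `^ (- q))%:E <= P (exact_recovery_event label A))%E.
Proof.
have K_gt0 : (0 < K)%N.
  case: K B0 pi {B0_sym pi_gt0 rank_L0 gap_L0} pi_sum1 => // B0' pi'.
  by rewrite big_ord0 => /eqP; rewrite eq_sym oner_eq0.
have Kp : 0 < K%:R :> R by rewrite ltr0n.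
have g_ge0 := lambda_max_ge0 pi K_gt0 B0_sym.
have form := lambda_max_form K_gt0 B0_sym pi_gt0.
have deg := lambda_min_le_degree B0 pi_gt0.
move: gap_L0 g_ge0 form deg; set g := lambda_max _; set h := lambda_min _.
move=> gh g_ge0 form deg.
have h_gt0 : 0 < h by exact: le_lt_trans gh.
pose gam := h - g; have gam_gt0 : 0 < gam by rewrite subr_gt0.
have gam_le : gam <= h by rewrite /gam; lra.
pose beta : R := 1 + \sum_r \sum_s `|B0 r s|.
have beta_ge1 : 1 <= beta.
  by rewrite lerDl sumr_ge0 // => r _; rewrite sumr_ge0.
have beta_gt0 : 0 < beta by lra.
have B0_le r s : `|B0 r s| <= beta.
  rewrite /beta (bigD1 r) //= (bigD1 s) //= addrCA -!addrA lerDl.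
  rewrite !addr_ge0 // sumr_ge0 // => t _; by rewrite sumr_ge0.
have [pm pm_gt0 pm_le] := @uniform_positive_bound R K (fun r => pi 0 r / 2)
  (fun r => divr_gt0 (pi_gt0 r) (ltr0n _ 2)).
(* sigma ^ 2 is a lower bound for the share of the squared length of a block
   vector that lies in the low eigenspace *)
pose sigma := gam / (2 * h).
have sigma_gt0 : 0 < sigma by rewrite divr_gt0 ?mulr_gt0.
(* K-medians requires K * delta * (8 + 2 / pm) < sigma *)
pose delta := sigma / (2 * K%:R * (8 + 2 / pm)).
have pmV : 0 < 8 + 2 / pm by rewrite addr_gt0 ?divr_gt0.
have delta_gt0 : 0 < delta by apply: divr_gt0 => //; apply: mulr_gt0 => //; apply: mulr_gt0.
have E1 := expR_gt0 (- 1 : R).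
(* noise level, in units of N: the three terms keep the gap open, make the
   remainder of the expansion at most 1 / n, and its geometric sum at most
   delta / 2 *)
pose e := Num.min (gam / 8) (Num.min (gam * expR (- 1) / (2 * K%:R))
  (delta * gam ^+ 2 / (16 * K%:R * beta))).
have e_gt0 : 0 < e.
  by rewrite !lt_min; apply/and3P; split; apply: divr_gt0 => //; do !apply: mulr_gt0 => //; rewrite exprn_gt0.
have e_le1 : e <= gam / 8 by rewrite ge_min lexx.
have e_le2 : e <= gam * expR (- 1) / (2 * K%:R) by rewrite !ge_min lexx !orbT.
have e_le3 : e <= delta * gam ^+ 2 / (16 * K%:R * beta) by rewrite !ge_min lexx !orbT.
clearbody e.
(* relative error allowed on the proportions n_r / n *)
pose eta := gam / (64 * h).
have eta_gt0 : 0 < eta by rewrite divr_gt0 ?mulr_gt0.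
have eta_h : eta * h = gam / 64 by rewrite /eta; field; rewrite lt0r_neq0.
have eta_le : eta <= 1 / 64.
  by rewrite -(ler_pM2r h_gt0) eta_h; lra.
pose g1 := g + gam / 8; pose h1 := h - gam / 8.
have g1_ge0 : 0 <= g1 by rewrite /g1; lra.
have gap : g1 + e < h1 - e by rewrite /g1 /h1 /gam in e_le1 *; lra.
pose c := 4 + 128 * K%:R * beta * expR (q + 1) / e ^+ 2.
have c_ge : 128 * K%:R * beta * expR (q + 1) / e ^+ 2 <= c by rewrite /c; lra.
have c4 : 4 <= c.
  by rewrite lerDl divr_ge0 ?sqr_ge0 // !mulr_ge0 ?expR_ge0 // ltW.
exists c; split; first by lra.
move=> eps eps_cvg.
have eta_pm : 0 < 2 * eta * pm by do 2! apply: mulr_gt0 => //.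
have [n1 _ n1P] : \forall n \near \oo, `|eps n| < 2 * eta * pm.
  by move/cvgr0Pnorm_lt : eps_cvg; apply.
exists (maxn n1 (maxn (Num.truncn (expR 1 : R)).+1 (Num.truncn (4 / delta ^+ 2)).+1)).
move=> n label rho d T P A; rewrite !geq_max => /and3P[nn1 ne nd] p_near rho_gt0 B01 sbm N_ge.
have n_ge_e : expR 1 <= n%:R :> R.
  by rewrite ltW // (lt_le_trans (truncnS_gt _)) // ler_nat.
have n_ge_d : 4 / delta ^+ 2 <= n%:R.
  by rewrite ltW // (lt_le_trans (truncnS_gt _)) // ler_nat.
have np : 0 < n%:R :> R by apply: lt_le_trans n_ge_e; exact: expR_gt0.
have n_gt0 : (0 < n)%N by rewrite -(ltr0n R).
have ln1 : 1 <= ln n%:R :> R by rewrite -ler_expR lnK ?posrE.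
have [l /andP[lk k2]] := power_of_two_between ln1.
set N := n%:R * rho in N_ge.
have N_gt0 : 0 < N by rewrite mulr_gt0.
have B0_ge0 r s : 0 <= B0 r s.
  by have /andP[+ _] := B01 r s; rewrite mxE pmulr_rge0.
have pi_ge0 r : 0 <= pi 0 r by rewrite ltW.
have p_near' r : `|label_fraction R label r - pi 0 r| <= eta * pi 0 r.
  apply: le_trans (p_near r) _; apply: le_trans (ler_norm _) _.
  apply: le_trans (ltW (n1P n nn1)) _.
  by have := pm_le r; move/(ler_wpM2l (ltW eta_gt0)); lra.
have eta_lt1 : eta < 1 by lra.
have p_ge r : pm <= label_fraction R label r.
  have /andP[+ _] := proportion_bounds p_near' r; apply: le_trans.
  apply: le_trans (pm_le r) _; have := pi_ge0 r; have := ler_wpM2r (pi_ge0 r) eta_le; lra.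
have p_gt0 r : 0 < label_fraction R label r by apply: lt_le_trans (p_ge r).
have deg' r : h1 <= block_degree label B0 r.
  have := deg r; rewrite ger0_norm; last by rewrite sumr_ge0 // => s _; rewrite mulr_ge0.
  move=> /(degree_proportions B0_ge0 eta_lt1 p_near'); apply: le_trans.
  by rewrite mulrBl mul1r eta_h /h1; lra.
have form' (z : 'rV[R]_K) : 2^-1 * \sum_r \sum_s label_fraction R label r *
    label_fraction R label s * B0 r s * (z 0 r - z 0 s) ^+ 2 <=
    g1 * \sum_r label_fraction R label r * z 0 r ^+ 2.
  apply: (form_proportions B0_ge0 pi_ge0 eta_lt1 p_near' g1_ge0 _ (form z)).
  have ge : eta * g <= gam / 64 by rewrite -eta_h ler_wpM2l // ltW.
  have := ler_wpM2l (ltW eta_gt0) ge; have := ler_wpM2r (ltW gam_gt0) eta_le.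
  by rewrite /g1; move: ge eta_le gam_gt0; nra.
pose k := (2 ^ l)%N.
have k_gt0 : (0 < k)%N by rewrite expn_gt0.
pose kappa := (h1 - e) - (g1 + e).
have kappa_ge : gam / 2 <= kappa.
  by rewrite /kappa /g1 /h1 /gam in e_le1 *; lra.
have kappa_gt0 : 0 < kappa by apply: lt_le_trans kappa_ge; rewrite divr_gt0.
have q0 : 0 <= K%:R * e / kappa by rewrite divr_ge0 ?mulr_ge0 // ltW.
have q_exp : K%:R * e / kappa <= expR (- 1).
  rewrite ler_pdivrMr //.
  have := ler_wpM2l (ltW E1) kappa_ge.
  move: e_le2; rewrite ler_pdivlMr ?mulr_gt0 //; lra.
have q_half : K%:R * e / kappa <= 2^-1.
  apply: le_trans q_exp _; rewrite expRN lef_pV2 ?posrE ?expR_gt0 //.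
  exact: le_trans (expR_ge1Dx 1).
have theta_le := tail_exponent K_gt0 e_gt0 beta_ge1 c_ge ln1 N_ge (introT andP (conj lk k2)).
have hp : 0 < h1 - e by rewrite /h1; move: e_le1 gam_le gam_gt0; lra.
have sigma_le : sigma ^+ 2 <= 1 - (g1 + e) / (h1 - e).
  have -> : 1 - (g1 + e) / (h1 - e) = kappa / (h1 - e).
    by rewrite /kappa; field; rewrite lt0r_neq0.
  have sigma1 : sigma <= 1 by rewrite /sigma ler_pdivrMr ?mulr_gt0 //; lra.
  apply: (@le_trans _ _ sigma); first by rewrite expr2 ler_piMr // ltW.
  have -> : sigma = gam / 2 * h^-1 by rewrite /sigma; field; rewrite lt0r_neq0.
  apply: ler_pM => //; [by rewrite divr_ge0 // ltW|by rewrite invr_ge0 ltW|].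
  by rewrite lef_pV2 ?posrE // /h1; move: e_gt0 gam_gt0; lra.
have delta_small : 2 * (K%:R * delta + K%:R * delta * (2 + pm^-1)) < sigma - 2 * (K%:R * delta).
  have : K%:R * delta * (8 + 2 / pm) = sigma / 2.
    by rewrite /delta; field; rewrite !lt0r_neq0 //; move: pm_gt0; lra.
  by move: sigma_gt0; lra.
clearbody delta.
have delta_ge : 2 * (K%:R * e / kappa) * (beta / kappa) + (Num.sqrt n%:R)^-1 <= delta.
  have kV : kappa^-1 <= 2 / gam.
    by rewrite -[2 / gam]invf_div lef_pV2 ?posrE ?divr_gt0.
  have k0 : 0 <= kappa^-1 by rewrite invr_ge0 ltW.
  have step1 : 2 * (K%:R * e / kappa) * (beta / kappa) <= delta / 2.
    apply: (@le_trans _ _ (2 * (K%:R * e * (2 / gam)) * (beta * (2 / gam)))).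
      have Ke : 0 <= K%:R * e by rewrite mulr_ge0 ?ltW.
      have b_ge0 := ltW beta_gt0.
      apply: ler_pM.
      - by rewrite mulr_ge0 // mulr_ge0.
      - exact: mulr_ge0.
      - by rewrite ler_wpM2l // ler_wpM2l.
      - by rewrite ler_wpM2l.
    have -> : 2 * (K%:R * e * (2 / gam)) * (beta * (2 / gam)) =
        e * (16 * K%:R * beta) / (2 * gam ^+ 2) by field; rewrite lt0r_neq0.
    rewrite ler_pdivrMr ?mulr_gt0 ?exprn_gt0 //.
    move: e_le3; rewrite ler_pdivlMr; first by lra.
    by do 2! apply: mulr_gt0 => //.
  have step2 : (Num.sqrt n%:R)^-1 <= delta / 2.
    have d2 : 0 < 2 / delta by rewrite divr_gt0.
    rewrite -[delta / 2]invf_div lef_pV2 ?posrE ?sqrtr_gt0 //.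
    rewrite -ler_sqr ?nnegrE ?sqrtr_ge0 ?(ltW d2) //.
    by rewrite sqr_sqrtr ?(ltW np) // expr_div_n -natrX.
  by lra.
apply: (@recovery_probability_ge R d T P n K label (rho *: B0) A (fun w => small_noise label k (e * N)
  (noise_laplacian (edge_prob label (rho *: B0)) w)) _ B01 sbm).
  move=> t; rewrite -(adjacency_noise_laplacian t B0_sym sbm) => small chat.
  have [A_sym _ _ _] := sbm.
  apply: (deterministic_recovery n_gt0 K_gt0 rho_gt0 B0_sym _ _ g1_ge0 (ltW e_gt0) gap
    p_gt0 form' deg' small B0_le q_half k_gt0 _ delta_gt0 delta_ge pm_gt0 p_ge sigma_gt0
    sigma_le delta_small).
  - by apply/matrixP => i j; rewrite !mxE A_sym.
  - by move=> i j; rewrite mxE.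
  - exact: root_decay.
have p_le e' : edge_prob label (rho *: B0) e' <= rho * beta.
  rewrite /edge_prob; case: ifP => _; last by rewrite mulr_ge0 // ltW.
  by rewrite mxE ler_wpM2l ?(ltW rho_gt0) // (le_trans (ler_norm _)).
have Nb : N <= N * beta by rewrite ler_peMr // ltW.
have k_le : (2 * k)%:R <= N * beta.
  apply: le_trans Nb; apply: le_trans N_ge; rewrite natrM.
  have : 4 * ln n%:R <= c * ln n%:R by rewrite ler_wpM2r //; lra.
  lra.
have nr_le : n%:R * (rho * beta) <= N * beta by rewrite mulrA.
have b_gt0 : 0 < e * N by rewrite mulr_gt0.
set theta := 32 * (N * beta) * (2 ^ l)%:R / (e * N) ^+ 2 in theta_le.
have theta_ge0 : 0 <= theta.
  by rewrite divr_ge0 ?sqr_ge0 // !mulr_ge0 // ltW.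
have K1 : 1 <= K%:R :> R by rewrite ler1n.
have theta1 : theta <= 1.
  have : expR (- (q + 1)) <= 1 by rewrite -[leRHS]expR0 ler_expR; move: q_gt0; lra.
  have := ler_wpM2r theta_ge0 K1; move: theta_le theta_ge0.
  by move: (expR _) theta => a b; lra.
have := noise_tail label (edge_prob01 label B01) p_le n_gt0 nr_le k_le b_gt0 K_gt0 theta1.
move/le_trans; apply; apply: polynomial_tail => //; first exact: ltW.
exact: mulr_ge0 (mulr_ge0 (ler0n _ 2) (ler0n _ K)) theta_ge0.
Qed.
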